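(* Uniformly for every convex body $C\subset\mathbb{R}^2$, and uniformly for every closed interval $I\subset\mathbb{T}_{2\pi}$, it holds (as $\rho\to+\infty$) $$\int_I\left|\widehat{\mathbf{1}}_{C}(\rho\,\mathbf{u}(\theta))\right|^2 d\theta\preccurlyeq\rho^{-3}\left(P_C(I)+P_C(I+\pi)\right),$$ with the convention that if $P_C(I)+P_C(I+\pi)=0$, then the statement means $$\lim_{\rho\to+\infty}\rho^3\int_I\left|\widehat{\mathbf{1}}_{C}(\rho\,\mathbf{u}(\theta))\right|^2 d\theta=0.$$
   Context: For $p>0$, $\mathbb{T}_p=\mathbb{R}/p\mathbb{Z}$; $\mathbf{u}(\theta)=(\cos\theta,\sin\theta)$. A convex body is a bounded convex subset of $\mathbb{R}^2$ with non-empty interior. Intervals of angles $I$ are assumed non-trivial: $|I|>0$. The Fourier transform of the indicator function of $C$ is $\widehat{\mathbf{1}}_C(\boldsymbol{\xi})=\int_C e^{-2\pi i\mathbf{x}\cdot\boldsymbol{\xi}}\,d\mathbf{x}$. Let $\boldsymbol{\Gamma}_C:\mathbb{T}_{|\partial C|}\to\mathbb{R}^2$ be the arc-length parameterization of $\partial C$ ($|\partial C|$ is the perimeter). For $s\in\mathbb{T}_{|\partial C|}$ the set of normals at $s$ is $\nu_C(s)=\{\theta\in\mathbb{T}_{2\pi}:\inf_{\mathbf{a}\in C}\mathbf{a}\cdot\mathbf{u}(\theta)=\boldsymbol{\Gamma}_C(s)\cdot\mathbf{u}(\theta)\}$. The portion of perimeter of $C$ with respect to an interval $I\subset\mathbb{T}_{2\pi}$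 is the Lebesgue measure $P_C(I)=|\{s\in\mathbb{T}_{|\partial C|}:\nu_C(s)\cap I\neq\varnothing\}|$. Asymptotics: for functions $f,g$ on an unbounded set $U\subseteq[0,+\infty)$, $f(x)\preccurlyeq g(x)$ means that there is $c>0$ with $\limsup_{x\to+\infty}f(x)/g(x)\le c$. When $f=f_y,g=g_y$ depend on a parameter $y$, the relation holds uniformly in $y$ if the value $c$ does not depend on $y$. *)

(* Defs.v *)
From HB Require Import structures.
From mathcomp Require Import all_boot all_order all_algebra.
From mathcomp Require Import all_classical all_reals all_analysis.
From mathcomp Require Import complex.

Set Implicit Arguments.
Unset Strict Implicit.
Unset Printing Implicit Defensive.

Import Order.TTheory GRing.Theory Num.Theory.
Import numFieldNormedType.Exports.

Local Open Scope classical_set_scope.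
Local Open Scope ring_scope.
Local Open Scope complex_scope.

Definition dot {R : realType} (x y : R * R) : R := x.1 * y.1 + x.2 * y.2.

Definition enorm {R : realType} (x : R * R) : R := Num.sqrt (dot x x).

Definition u {R : realType} (t : R) : R * R := (cos t, sin t).

Definition convex_body {R : realType} (C : set (R * R)) : Prop :=
  [/\ bounded_set C, convex_set (C : set (R^o * R^o)%type) & C° !=set0].

Definition cintegral {d} {T : measurableType d} {R : realType}
    (mu : {measure set T -> \bar R}) (D : set T) (f : T -> R[i]) : R[i] :=
  (\int[mu]_(x in D) complex.Re (f x)) +i* (\int[mu]_(x in D) complex.Im (f x)).

Definition expi {R : realType} (t : R) : R[i] := cos t +i* sin t.

(* A convex body need not be a Borel set, but its boundary is Lebesgue-null, and
   the library integral of a nonnegative function is a supremum over simple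
   functions below it: the integral over C is the one over the closure of C. *)
Definition indic_hat {R : realType} (C : set (R * R)) (xi : R * R) : R[i] :=
  cintegral (lebesgue_measure \x lebesgue_measure)%E C
    (fun x : R * R => expi (- (2 * pi * dot x xi))).

Definition polyline_length {R : realType} (G : R -> R * R) (a b : R)
    (s : seq R) : R :=
  \sum_(0 <= n < size s)
    enorm (G (nth b (a :: s) n.+1) - G (nth b (a :: s) n)).

Definition curve_length {R : realType} (G : R -> R * R) (a b : R) : \bar R :=
  ereal_sup [set (polyline_length G a b s)%:E | s in itv_partition a b].

Definition boundary {R : realType} (C : set (R * R)) : set (R * R) :=
  closure C `\` C°.

(* Functions on R / L Z are L-periodic functions on R, and likewise a set of
   angles modulo 2 pi is represented by a set of reals lifting it. The number L is forced to
   be the perimeter of C, and G is unique up to translation and reversal of the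
   parameter. *)
Definition arclength_param {R : realType} (C : set (R * R)) (L : R)
    (G : R -> R * R) : Prop :=
  [/\ 0 < L,
      periodic G L,
      {in `[0, L[ &, injective G},
      range G = boundary C &
      forall s t, s <= t -> curve_length G s t = (t - s)%:E].

Definition normals {R : realType} (C : set (R * R)) (G : R -> R * R) (s : R) :
    set R :=
  [set t | inf [set dot a (u t) | a in C] = dot (G s) (u t)].

Definition perimeter_portion {R : realType} (C : set (R * R)) (L : R)
    (G : R -> R * R) (I : set R) : R :=
  fine (lebesgue_measure [set s | 0 <= s < L /\ normals C G s `&` I !=set0]).

(* The relation f(x) <~ g(x) as x -> +oo, with constant c; uniformity of a family
   of such relations means that they hold with the same c. *)
Definition preceq_with {R : realType} (c : R) (f g : R -> R) : Prop :=
  (limf_esup (fun x => (f x / g x)%:E) (pinfty_nbhs R) <= c%:E)%E.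

(* Main.v *)
(* Slice C perpendicularly to u(theta): the chord length f is concave on its
   support.  If g is antiperiodic with antiperiod h = 1/(2 rho) and |g| <= 1, then
   4 int f g = int (D f) (1 + g), where D f is the second difference of f with step h and
   has integral 0; D f <= 0 away from the two ends of the support, so only caps of
   depth 1/rho contribute, and |hat 1_C(rho u(theta))| <= c / rho times the widths of the
   two caps orthogonal to u(theta).

   It remains to bound the integral over I of the squared width l(theta)^2 of the cap
   of depth d = 1/rho by a constant times d * |S|, S being the set of boundary parameters
   that lie in a cap for some theta in I.  A proportion of l(theta) of these points sits
   under the middle half of the cap.  If a point y sits under the middle half of the cap
   for theta and almost in the cap for theta', then |theta - theta'| l(theta) <= c d,
   since turning by theta' - theta lowers one side of the cap below y; hence for fixed y
   the integral of l(theta) over such theta is at most c d.  Summing over y in a fine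
   grid of boundary points gives the bound.  As d -> 0, |S| tends to P_C(I) by
   compactness. *)

Require Import Defs.
From HB Require Import structures.
From mathcomp Require Import all_boot all_order all_algebra.
From mathcomp Require Import all_classical all_reals all_analysis.
From mathcomp Require Import complex.
From mathcomp Require Import measurable_realfun.
From mathcomp Require Import ring lra.

Set Implicit Arguments.
Unset Strict Implicit.
Unset Printing Implicit Defensive.

Import Order.TTheory GRing.Theory Num.Theory.
Import numFieldNormedType.Exports.

Local Open Scope classical_set_scope.
Local Open Scope ring_scope.

(** * Translations of Lebesgue measure *)

Section translation.
Context {R : realType}.
Local Notation mu := (@lebesgue_measure R).
Local Open Scope ereal_scope.

Lemma lebesgue_measureDr (r : R) (A : set R) : measurable A ->
  pushforward mu (fun x : R => (x + r)%R : measurableTypeR R) A = mu A.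
Proof.
have mf : measurable_fun [set: R] (fun x : R => (x + r)%R : measurableTypeR R).
  exact: measurable_funD.
pose m := pushforward mu (fun x : R => (x + r)%R : measurableTypeR R).
move=> mA; apply/esym.
apply: (@lebesgue_measure_unique R m _ _ mA) => //= _ [[a b]] _ <-.
rewrite /m /pushforward /=.
rewrite (_ : _ @^-1` _ = `](a - r)%R, (b - r)%R]%classic); last first.
  by apply/seteqP; split => x /=; rewrite !in_itv/= => /andP[? ?];
    apply/andP; split; lra.
rewrite !lebesgue_measure_itv/= !lte_fin ltrD2r.
by case: ifP => // _; rewrite -!EFinB; congr EFin; ring.
Qed.

Lemma ge0_integralDr (r : R) (f : R -> \bar R) : measurable_fun setT f ->
  (forall x, 0 <= f x) -> \int[mu]_x f (x + r)%R = \int[mu]_x f x.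
Proof.
move=> mf f0.
have mD : measurable_fun [set: R] (fun x : R => (x + r)%R : measurableTypeR R).
  exact: measurable_funD.
rewrite -[LHS](@ge0_integral_pushforward _ _ (measurableTypeR R)
  (measurableTypeR R) R (fun x => x + r)%R mD mu setT f measurableT mf) //.
by apply: eq_measure_integral => A mA _; exact: lebesgue_measureDr.
Qed.

Lemma integralDr (r : R) (f : R -> \bar R) : measurable_fun setT f ->
  \int[mu]_x f (x + r)%R = \int[mu]_x f x.
Proof.
move=> mf; rewrite integralE [RHS]integralE.
rewrite -[in RHS](ge0_integralDr r (measurable_funepos mf)); last exact: funepos_ge0.
rewrite -[in RHS](ge0_integralDr r (measurable_funeneg mf)); last exact: funeneg_ge0.
by congr (_ - _); apply: eq_integral => x _; rewrite ?funeposE ?funenegE.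
Qed.

Lemma integrableDr (r : R) (f : R -> \bar R) :
  mu.-integrable setT f -> mu.-integrable setT (fun x => f (x + r)%R).
Proof.
move=> /integrableP[mf fi]; apply/integrableP; split.
  by apply: measurableT_comp => //; exact: measurable_funD.
rewrite (@ge0_integralDr r (fun x => `|f x|)) //.
exact: measurableT_comp.
Qed.

End translation.

(** * Integration against an antiperiodic function *)

Section antiperiodic.
Context {R : realType}.
Local Notation mu := (@lebesgue_measure R).

Lemma RintegralDr (r : R) (f : R -> R) : measurable_fun setT f ->
  \int[mu]_x f (x + r) = \int[mu]_x f x.
Proof.
move=> mf; rewrite /Rintegral; congr fine.
by rewrite -(integralDr r (f := EFin \o f))//; exact/measurable_EFinP.
Qed.

Lemma Rintegral_indic_itv (a b c : R) : a <= b ->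
  \int[mu]_x (c * \1_(`[a, b]%classic : set R) x) = c * (b - a).
Proof.
move=> ab; rewrite RintegralZl//; last exact: integrable_indic_itv.
congr (_ * _); rewrite /Rintegral integral_indic//= setIT.
rewrite lebesgue_measure_itv/= lte_fin; case: ltgtP ab => //= -> _.
by rewrite subrr.
Qed.

(** The second difference of [f] with step [h], multiplied by [1 + g], integrates to four times the
    integral of [f * g]. As [1 + g] lies between 0 and 2, only upper bounds of the second difference
    matter. It can be positive only on two windows of length [2 * h], where the product is at most
    [4 * B]; this gives [16 * h * B] before division by 4. *)
Lemma le_Rintegral_antiperiodic (f g : R -> R) (h a b B : R) :
  0 < h -> a <= b ->
  mu.-integrable setT (EFin \o f) ->
  (forall t, 0 <= f t) ->
  (forall t, t < a -> f t = 0) -> (forall t, b < t -> f t = 0) ->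
  (forall t, a <= t <= a + 2 * h -> f t <= B) ->
  (forall t, b - 2 * h <= t <= b -> f t <= B) ->
  (forall t, a < t -> t + 2 * h < b -> f t + f (t + 2 * h) <= 2 * f (t + h)) ->
  measurable_fun setT g -> (forall t, `|g t| <= 1) ->
  (forall t, g (t + h) = - g t) ->
  \int[mu]_x (f x * g x) <= 4 * h * B.
Proof.
move=> h0 ab fi f0 fa fb fB1 fB2 fc mg g1 gh.
have mf : measurable_fun setT f by apply/measurable_EFinP; exact: (measurable_int mu fi).
have B0 : 0 <= B by apply: (le_trans (f0 a)); apply: fB1; apply/andP; split; lra.
pose F t := f t * g t.
have mF : measurable_fun setT F by exact: measurable_funM.
have Fi : mu.-integrable setT (EFin \o F).
  apply: (le_integrable measurableT _ _ fi); first exact/measurable_EFinP.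
  move=> x _ /=; rewrite lee_fin /F normrM ler_piMr//.
(* [A] is f(1+g) and [A'] is -2f(1-g). A shift by [h] changes the sign of [g] and a shift by [2 * h]
   restores it, so the shifted copies assemble into the second difference of [f] times 1+g. *)
pose A t := f t + F t.
pose A' t := 2 * F t + -2 * f t.
have mA : measurable_fun setT A by exact: measurable_funD.
have mA' : measurable_fun setT A'.
  by apply: measurable_funD; exact: measurable_funM.
have Ai : mu.-integrable setT (EFin \o A).
  by apply: eq_integrable (integrableD measurableT fi Fi) => //.
have A'i : mu.-integrable setT (EFin \o A').
  have := integrableD measurableT (integrableZl measurableT 2 Fi)
    (integrableZl measurableT (-2) fi).
  by apply: eq_integrable.

have sA r : mu.-integrable setT (EFin \o (fun t => A (t + r))).
  exact: (integrableDr r Ai).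
have sA' r : mu.-integrable setT (EFin \o (fun t => A' (t + r))).
  exact: (integrableDr r A'i).
have sA2 : mu.-integrable setT (EFin \o (fun t => A t + A (t + 2 * h))).
  by apply: eq_integrable (integrableD measurableT Ai (sA (2 * h))).
have sD : mu.-integrable setT
    (EFin \o (fun t => A t + A (t + 2 * h) + A' (t + h))).
  by apply: eq_integrable (integrableD measurableT sA2 (sA' h)).
have E : \int[mu]_x (A x + A (x + 2 * h) + A' (x + h)) = 4 * \int[mu]_x F x.
  rewrite RintegralD// RintegralD//.
  rewrite (RintegralDr (2 * h) (f := A))//.
  rewrite (RintegralDr h (f := A'))//.
  have -> : \int[mu]_x A x = \int[mu]_x f x + \int[mu]_x F x by exact: RintegralD.
  have -> : \int[mu]_x A' x = 2 * \int[mu]_x F x + -2 * \int[mu]_x f x.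
    rewrite RintegralD//; first by rewrite !RintegralZl.
      by apply: eq_integrable (integrableZl measurableT 2 Fi).
    by apply: eq_integrable (integrableZl measurableT (-2) fi).
  ring.
have S1 := integrable_indic_itv (a - 2 * h) a true false.
have S2 := integrable_indic_itv (b - 2 * h) b true false.
have T1 := integrableZl measurableT (4 * B) S1.
have T2 := integrableZl measurableT (4 * B) S2.
have : \int[mu]_x (A x + A (x + 2 * h) + A' (x + h)) <=
    \int[mu]_x (4 * B * \1_(`[a - 2 * h, a]%classic : set R) x
              + 4 * B * \1_(`[b - 2 * h, b]%classic : set R) x).
  apply: le_Rintegral => //.
    by apply: eq_integrable (integrableD measurableT T1 T2).
  move=> t _.
  have g2 : g (t + 2 * h) = g t.
    by rewrite (_ : t + 2 * h = t + h + h) ?gh ?opprK//; ring.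
  have -> : A t + A (t + 2 * h) + A' (t + h) =
      (f t - 2 * f (t + h) + f (t + 2 * h)) * (1 + g t).
    by rewrite /A /A' /F g2 gh; ring.
  have /ler_normlP[g3 g4] := g1 t.
  have I0 (x y z : R) : 0 <= 4 * B * \1_(`[x, y]%classic : set R) z.
    by rewrite mulr_ge0 ?mulr_ge0// indicE.
  have I1 (x y z : R) : x <= z <= y -> 4 * B * \1_(`[x, y]%classic : set R) z = 4 * B.
    by move=> xzy; rewrite indicE mem_set ?mulr1//= in_itv/= xzy.
  have f1 := f0 t; have f2 := f0 (t + h); have f3 := f0 (t + 2 * h).
  have key : f t - 2 * f (t + h) + f (t + 2 * h) <= 2 * B -> 
      (f t - 2 * f (t + h) + f (t + 2 * h)) * (1 + g t) <= 4 * B.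
    move=> H; apply: (@le_trans _ _ (2 * B * (1 + g t))).
      by rewrite ler_wpM2r//; lra.
    by rewrite (_ : 4 * B = 2 * B * 2) ?ler_wpM2l//; [lra|lra|ring].
  (* Outside [a-2h, b] all three values of [f] vanish; the windows [a-2h, a] and [b-2h, b] use
     [key]; in between the second difference is nonpositive. The points where an argument equals [a]
     or [b] are treated apart, since [f] may be nonzero there. *)
  have [ta|ta] := ltP t (a - 2 * h).
    rewrite !fa; [|lra..].
    by rewrite mulr0 subr0 addr0 mul0r addr_ge0.
  have [tb|tb] := ltP b t.
    rewrite !fb; [|lra..].
    by rewrite mulr0 subr0 addr0 mul0r addr_ge0.
  have [ta'|ta'] := leP t a.
    rewrite I1; last by apply/andP; split.
    rewrite -[leLHS]addr0 lerD//; apply: key.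
    have : f t <= B.
      have [->|tna] := eqVneq t a; first by apply: fB1; apply/andP; split; lra.
      by rewrite fa// lt_neqAle tna.
    have : f (t + 2 * h) <= B.
      have [th|th] := leP a (t + 2 * h); last by rewrite fa.
      by apply: fB1; apply/andP; split; lra.
    lra.
  have [tb'|tb'] := leP (b - 2 * h) t.
    rewrite [leRHS]addrC I1; last by apply/andP; split.
    rewrite -[leLHS]addr0 lerD//; apply: key.
    have : f t <= B by apply: fB2; apply/andP; split.
    have : f (t + 2 * h) <= B.
      have [th|th] := eqVneq (t + 2 * h) b; last first.
        by rewrite fb//; rewrite lt_neqAle eq_sym th/=; lra.
      by apply: fB2; apply/andP; split; lra.
    lra.
  apply: (@le_trans _ _ 0); last by rewrite addr_ge0.
  by rewrite mulr_le0_ge0//; [have := fc t ta'; lra | lra].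
rewrite E RintegralD// !Rintegral_indic_itv; [|lra..].
rewrite -/F; lra.
Qed.

(** The one-sided bound is applied to [g] and to its negative, which is antiperiodic too. *)
Lemma normr_Rintegral_antiperiodic (f g : R -> R) (h a b B : R) :
  0 < h -> a <= b ->
  mu.-integrable setT (EFin \o f) ->
  (forall t, 0 <= f t) ->
  (forall t, t < a -> f t = 0) -> (forall t, b < t -> f t = 0) ->
  (forall t, a <= t <= a + 2 * h -> f t <= B) ->
  (forall t, b - 2 * h <= t <= b -> f t <= B) ->
  (forall t, a < t -> t + 2 * h < b -> f t + f (t + 2 * h) <= 2 * f (t + h)) ->
  measurable_fun setT g -> (forall t, `|g t| <= 1) ->
  (forall t, g (t + h) = - g t) ->
  `|\int[mu]_x (f x * g x)| <= 4 * h * B.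
Proof.
move=> h0 ab fi f0 fa fb fB1 fB2 fc mg g1 gh.
have mf : measurable_fun setT f by apply/measurable_EFinP; exact: (measurable_int mu fi).
rewrite ler_norml; apply/andP; split; last first.
  exact: (le_Rintegral_antiperiodic h0 ab).
have Fi : mu.-integrable setT (EFin \o (fun x => f x * g x)).
  apply: (le_integrable measurableT _ _ fi).
    by apply/measurable_EFinP; exact: measurable_funM.
  by move=> x _ /=; rewrite lee_fin normrM ler_piMr.
have := le_Rintegral_antiperiodic (g := fun t => - g t) h0 ab fi f0 fa fb fB1 fB2 fc.
rewrite (_ : \int[mu]_x (f x * - g x) = - \int[mu]_x (f x * g x)); last first.
  rewrite -mulN1r -RintegralZl//; apply: eq_Rintegral => x _; ring.
rewrite lerNl; apply.
- exact: measurableT_comp.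
- by move=> t; rewrite normrN.
- by move=> t; rewrite gh.
Qed.

End antiperiodic.

(** * Measurability in the plane *)

Section plane_measure.
Context {R : realType}.
Local Notation mu := (@lebesgue_measure R).
Local Notation mu2 := (mu \x mu)%E.

Lemma natSinv_lt (e : R) : 0 < e -> exists n : nat, n.+1%:R^-1 < e.
Proof.
move=> e0; have [n _ nP] := near_infty_natSinv_lt (PosNum e0).
by exists n; exact: (nP n (leqnn n)).
Qed.

(** The sigma-algebra on the plane is the product one, so an open set is written as a countable
    union of boxes with rational centres and radii 1/(n+1). *)
Lemma open_measurable_plane (U : set (R * R)) : open U -> measurable U.
Proof.
move=> oU.
pose box (q : rat * rat * nat) : set (R * R) :=
  ball (ratr q.1.1 : R) q.2.+1%:R^-1 `*` ball (ratr q.1.2 : R) q.2.+1%:R^-1.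
pose F q : set (R * R) := if `[< box q `<=` U >] then box q else set0.
rewrite (_ : U = \bigcup_q F q).
  apply: countable_bigcupT_measurable; first exact: countableP.
  move=> q; rewrite /F; case: ifP => // _.
  by apply: measurableX; exact: measurable_ball.
apply/seteqP; split => [[x y] Uxy|z [q _]]; last first.
  by rewrite /F; case: ifPn => // /asboolP; apply.
have /nbhs_ballP[e /= e0 eU] := open_nbhs_nbhs (conj oU Uxy).
have [n nP] : exists n : nat, n.+1%:R^-1 < e / 2 by apply: natSinv_lt; lra.
have r0 : 0 < n.+1%:R^-1 :> R by rewrite invr_gt0.
have [r rE] : exists r : R, r = n.+1%:R^-1 by exists n.+1%:R^-1.
rewrite -rE in nP r0.
have qP (z : R) : exists q : rat, z - r < ratr q < z + r.
  have [|q] := @rat_in_itvoo R (z - r) (z + r); first lra.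
  by rewrite in_itv/=; exists q.
have [[q1 /andP[q11 q12]] [q2 /andP[q21 q22]]] := (qP x, qP y).
exists (q1, q2, n) => //; rewrite /F asboolT/=.
  by split => /=; rewrite /ball/= -rE ltr_norml; apply/andP; split; lra.
move=> [a b]/= [/=]; rewrite /ball/= -rE !ltr_norml => /andP[? ?] /andP[? ?].
apply: eU; split; rewrite /ball/= ltr_norml; apply/andP; split; lra.
Qed.

Lemma closed_measurable_plane (K : set (R * R)) : closed K -> measurable K.
Proof.
by move/closed_openC/open_measurable_plane/measurableC; rewrite setCK.
Qed.

Definition square (M : R) : set (R * R) := `[- M, M]%classic `*` `[- M, M]%classic.

Lemma measurable_square M : measurable (square M).
Proof. exact: measurableX. Qed.

Lemma mu2_square_lty M : (mu2 (square M) < +oo)%E.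
Proof.
rewrite product_measure1E//= lebesgue_measure_itv/= lte_fin.
by case: ifP => _; rewrite ?mule0 ?ltry// -EFinB -EFinM ltry.
Qed.

Lemma integrable_square (F : R * R -> R) (M B : R) :
  measurable_fun setT F -> (forall x, `|F x| <= B) ->
  (forall x, ~ square M x -> F x = 0) -> mu2.-integrable setT (EFin \o F).
Proof.
move=> mF FB F0.
have : mu2.-integrable (square M) (EFin \o F).
  apply: measurable_bounded_integrable.
  - exact: measurable_square.
  - exact: mu2_square_lty.
  - exact: measurable_funS mF.
  - exists B; split; first exact: num_real.
    by move=> x Bx y _ /=; exact: (le_trans (FB y) (ltW Bx)).
move=> H; have := iffLR (integrable_mkcond (mu := mu2) (EFin \o F) (measurable_square M)) H.
apply: eq_integrable => // x _; rewrite patchE.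
by case: ifPn => // /negP xM /=; rewrite F0// => /mem_set.
Qed.

End plane_measure.

(** * Slicing *)

Section sections.
Context {R : realType}.
Local Notation mu := (@lebesgue_measure R).
Local Notation mu2 := (mu \x mu)%E.

Lemma lebesgue_measure_interval (S : set R) :
  is_interval S -> S !=set0 -> has_lbound S -> has_ubound S ->
  mu S = (sup S - inf S)%:E.
Proof.
move=> /is_intervalP SE S0 Sl Su.
rewrite [in LHS]SE lebesgue_measure_itv /Rhull (asboolT Sl) (asboolT Su)/= lte_fin.
case: ltP => // si; rewrite (_ : sup S - inf S = 0)//.
apply/eqP; rewrite subr_eq0 eq_le si /=.
by case: S0 => x Sx; exact: le_trans (ge_inf Sl Sx) (ub_le_sup Su Sx).
Qed.

(** The set lies in the interval of length [D] that starts at its infimum. *)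
Lemma lebesgue_measure_le_diam (S : set R) (D : R) :
  (forall x y, S x -> S y -> y - x <= D) -> 0 <= D -> (mu S <= D%:E)%E.
Proof.
move=> SD D0; have [->|/set0P[x0 Sx0]] := eqVneq S set0; first by rewrite measure0.
have Sl : has_lbound S by exists (x0 - D) => y Sy; have := SD _ _ Sy Sx0; lra.
have Si : has_inf S by split => //; exists x0.
apply: (@le_trans _ _ (mu `[inf S, inf S + D]%classic)).
  apply: le_outer_measure => x Sx /=; rewrite in_itv/= ge_inf//= -lerBlDr.
  by apply: lb_le_inf; [exists x0|move=> y Sy; have := SD _ _ Sy Sx; lra].
rewrite lebesgue_measure_itv/= lte_fin; case: ifP => // _.
by rewrite -EFinB lee_fin; lra.
Qed.

Lemma integrable_indic_lty d (T : measurableType d)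
    (nu : {measure set T -> \bar R}) (A : set T) :
  measurable A -> (nu A < +oo)%E -> nu.-integrable setT (EFin \o (\1_A : T -> R)).
Proof.
move=> mA Aoo; apply/integrableP; split.
  by apply/measurable_EFinP; exact: measurable_indic.
rewrite (eq_integral (fun r => (\1_A r)%:E)); last first.
  by move=> r _; rewrite /= ger0_norm// indicE ler0n.
by rewrite integral_indic// setIT.
Qed.

Definition perp (n : R * R) : R * R := (- n.2, n.1).

Definition plane_convex (K : set (R * R)) := forall p q t, K p -> K q ->
  0 <= t <= 1 -> K ((1 - t) * p.1 + t * q.1, (1 - t) * p.2 + t * q.2).

(** The smallest values of [dot _ n] are at the cap, so [n] is an inner normal, as in [normals]. At
    [d = 0] the cap is the contact set with the supporting line. *)
Definition cap (K : set (R * R)) (n : R * R) (d : R) : set (R * R) :=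
  [set p | K p /\ forall z, K z -> dot p n <= dot z n + d].

Definition cap_width_le (K : set (R * R)) (n : R * R) (d W : R) :=
  forall p q, cap K n d p -> cap K n d q ->
    dot q (perp n) - dot p (perp n) <= W.

Section shear.
Variables (K : set (R * R)) (M : R) (n : R * R).
Hypotheses (mK : measurable K) (KM : K `<=` square M) (n0 : 0 < n.1).

(** The line where [dot z n] equals [n.1 * y] consists of the points [(y - r * k, r)], so [T] is an
    area-preserving shear that carries vertical lines to lines orthogonal to [n]. The value [f y]
    measures the slice through its second coordinate: it is [n.1] times the length of the chord. *)
Let k := n.2 / n.1.
Let T (z : R * R) : R * R := (z.1 - z.2 * k, z.2).
Let S (y : R) : set R := [set r | K (y - r * k, r)].
Let f (y : R) : R := fine (mu (S y)).

Let mT : measurable_fun setT T.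
Proof.
apply/measurable_fun_pairP; split => /=; last exact: measurable_snd.
apply: measurable_funB; first exact: measurable_fst.
by apply: measurable_funM => //; exact: measurable_snd.
Qed.

Let mKT : measurable (T @^-1` K).
Proof. by rewrite -[_ @^-1` _]setTI; exact: mT. Qed.

Lemma shear_section_fin y : mu (S y) = (f y)%:E.
Proof.
rewrite fineK// ge0_fin_numE//.
apply: (@le_lt_trans _ _ (mu `[- M, M]%classic)).
  by apply: le_outer_measure => r /KM[].
rewrite lebesgue_measure_itv/= lte_fin.
by case: ifP => _; rewrite ?ltry// -EFinB ltry.
Qed.

Let shear_section_lty y : (mu (S y) < +oo)%E.
Proof. by rewrite shear_section_fin ltry. Qed.

(** The change of variables by the shear amounts to a translation on each horizontal line, between
    two uses of Fubini. *)
Lemma Rintegral_shear (g : R -> R) : measurable_fun setT g ->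
  (forall t, `|g t| <= 1) ->
  mu.-integrable setT (EFin \o f) /\
  \int[mu2]_(x in K) g (dot x n) = \int[mu]_y (f y * g (n.1 * y)).
Proof.
move=> mg g1.
(* The sheared set stays in a larger square, which makes its indicator times a bounded function
   integrable. *)
have TM z : (T @^-1` K) z -> square (M + M * `|k|) z.
  move=> /KM[/=]; rewrite !in_itv/= => /andP[z1 z2] /andP[z3 z4].
  have : `|z.2 * k| <= M * `|k|.
    by rewrite normrM ler_wpM2r// ler_norml z3.
  have : 0 <= M * `|k| by rewrite mulr_ge0//; lra.
  rewrite ler_norml => ? /andP[? ?].
  by split => /=; rewrite in_itv/=; apply/andP; split; lra.
have mS y : measurable (S y).
  have -> : S y = xsection (T @^-1` K) y.
    by apply/seteqP; split => r; rewrite /xsection/= inE.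
  exact: measurable_xsection.
pose Psi (g : R -> R) z := \1_(T @^-1` K) z * g (n.1 * z.1).
have PsiE (g' : R -> R) y :
    (\int[mu]_r (Psi g' (y, r))%:E = (f y * g' (n.1 * y))%:E)%E.
  transitivity (\int[mu]_r ((g' (n.1 * y))%:E * (\1_(S y) r)%:E))%E.
    by apply: eq_integral => r _; rewrite /Psi mulrC EFinM !indicE.
  rewrite integralZl//; last first.
    by apply: integrable_indic_lty; [exact: mS|exact: shear_section_lty].
  have -> : (\int[mu]_r (\1_(S y) r)%:E = (f y)%:E)%E; last by rewrite -EFinM mulrC.
  rewrite -shear_section_fin.
  have := integral_indic mu measurableT (mS y).
  by rewrite setIT.
have Psi_int (g' : R -> R) : measurable_fun setT g' -> (forall t, `|g' t| <= 1) ->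
    mu2.-integrable setT (EFin \o Psi g').
  move=> mg' g'1; apply: (@integrable_square _ _ (M + M * `|k|) 1).
  - apply: measurable_funM; first exact: measurable_indic.
    exact: (measurableT_comp mg' (measurable_funM (measurable_cst _) measurable_fst)).
  - move=> z; rewrite normrM mulr_ile1// indicE.
    by case: (_ \in _); rewrite ?normr1 ?normr0.
  - move=> z zM; rewrite /Psi indicE memNset ?mul0r//.
    by move=> ?; apply/zM/TM.
split.
  have one1 (t : R) : `|(fun=> 1 : R) t| <= 1 by rewrite normr1.
  apply: eq_integrable (integrable_fubini_F (Psi_int _ (measurable_cst _) one1)) => //.
  by move=> y _; rewrite /fubini_F PsiE mulr1.
rewrite Rintegral_mkcond /Rintegral; congr fine.
transitivity (\int[mu2]_z (\1_K z * g (dot z n))%:E)%E.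
  apply: eq_integral => z _; rewrite patchE indicE.
  by case: ifP => _ /=; rewrite ?mul1r ?mul0r.
have mPhi : measurable_fun setT (fun z => \1_K z * g (dot z n)).
  apply: measurable_funM; first exact: measurable_indic.
  apply: (measurableT_comp mg).
  exact: (measurable_funD (measurable_funM measurable_fst (measurable_cst _))
    (measurable_funM measurable_snd (measurable_cst _))).
rewrite -integral21_prod_meas1; last first.
  apply: (@integrable_square _ _ M 1) => //.
  - move=> z; rewrite normrM mulr_ile1// indicE.
    by case: (_ \in _); rewrite ?normr1 ?normr0.
  - move=> z zM; rewrite indicE memNset ?mul0r//.
    by move=> ?; apply/zM/KM.
transitivity (\int[mu]_r \int[mu]_y (Psi g (y, r))%:E)%E.
  apply: eq_integral => r _; rewrite /fubini_G.
  (* At height [r] the shear is the translation by [- (r * k)]. *)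
  rewrite -[LHS](integralDr (- (r * k))); last first.
    by apply/measurable_EFinP; exact: (measurableT_comp mPhi (pair2_measurable r)).
  apply: eq_integral => y _; rewrite /Psi !indicE /dot/=.
  congr (_ * g _)%:E.
  by rewrite /k; field; rewrite gt_eqF.
rewrite -(Fubini (Psi_int _ mg g1)).
by apply: eq_integral => y _; rewrite PsiE.
Qed.

End shear.
End sections.

(** * Oscillatory integrals over a convex set bounded by cap widths *)

Section cap_bound.
Context {R : realType}.
Local Notation mu := (@lebesgue_measure R).
Local Notation mu2 := (mu \x mu)%E.

(** In the slicing variable [y] the antiperiod becomes [h / n.1], and a section near an end has
    measure at most [n.1 * W]; the two factors [n.1] cancel in the bound for the antiperiodic
    integral. *)
Lemma normr_Rintegral_cap_pos (K : set (R * R)) (M : R) (n : R * R)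
    (g : R -> R) (h W : R) :
  measurable K -> K `<=` square M -> plane_convex K -> K !=set0 ->
  0 < n.1 -> n.1 ^+ 2 + n.2 ^+ 2 = 1 -> 0 < h -> 0 <= W ->
  measurable_fun setT g -> (forall t, `|g t| <= 1) ->
  (forall t, g (t + h) = - g t) ->
  cap_width_le K n (2 * h) W -> cap_width_le K (- n) (2 * h) W ->
  `|\int[mu2]_(x in K) g (dot x n)| <= 4 * h * W.
Proof.
move=> mK KM convK K0 n0 n1 h0 W0 mg g1 gh capn capN.
pose k := n.2 / n.1.
pose S (y : R) : set R := [set r | K (y - r * k, r)].
pose f (y : R) : R := fine (mu (S y)).
have [fi ->] := Rintegral_shear mK KM n0 mg g1.
have SE y : mu (S y) = (f y)%:E by exact: shear_section_fin KM y.
have dotS y r : S y r -> dot (y - r * k, r) n = n.1 * y.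
  by move=> _; rewrite /dot /k/=; field; rewrite gt_eqF.
have Sconv y1 y2 r1 r2 t : S y1 r1 -> S y2 r2 -> 0 <= t <= 1 ->
    S ((1 - t) * y1 + t * y2) ((1 - t) * r1 + t * r2).
  move=> S1 S2 t01; have := convK _ _ t S1 S2 t01; rewrite /S/=.
  by congr (K (_, _)); ring.
have Sitv y : is_interval (S y).
  move=> x z Sx Sz w /andP[xw wz].
  have [xz|xz] := eqVneq x z; first by rewrite (_ : w = x)//; lra.
  have zx0 : 0 < z - x by rewrite subr_gt0 lt_neqAle xz; lra.
  have := Sconv _ _ _ _ ((w - x) / (z - x)) Sx Sz.
  rewrite (_ : _ + _ * y = y); last by ring.
  rewrite (_ : _ + _ * z = w); last by field; rewrite gt_eqF.
  apply; apply/andP; split; first by rewrite divr_ge0//; lra.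
  by rewrite ler_pdivrMr//; lra.
have SM y r : S y r -> - M <= r <= M by move=> /KM[_]/=; rewrite in_itv/=.
have Sl y : has_lbound (S y) by exists (- M) => r /SM/andP[].
have Su y : has_ubound (S y) by exists M => r /SM/andP[].
have fE y : S y !=set0 -> f y = sup (S y) - inf (S y).
  by move=> Sy; rewrite /f lebesgue_measure_interval.
have f0E y : ~ (S y !=set0) -> f y = 0.
  by move=> /set0P/negP; rewrite negbK => /eqP Sy; rewrite /f Sy measure0.
pose Y := [set y | S y !=set0].
have KY z : K z -> Y (z.1 + z.2 * k).
  by case: z => z1 z2 Kz; exists z2; rewrite /S/= addrK.
have Y0 : Y !=set0 by case: K0 => z /KY; eexists; eassumption.
have YM y : Y y -> `|y| <= M + M * `|k|.
  move=> [r Sr]; have /andP[r1 r2] := SM _ _ Sr.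
  have := KM _ Sr; case => /=; rewrite !in_itv/= => /andP[? ?] _.
  have : `|r * k| <= M * `|k| by rewrite normrM ler_wpM2r// ler_norml r1.
  by rewrite !ler_norml => /andP[? ?]; apply/andP; split; lra.
have Yl : has_lbound Y.
  by exists (- (M + M * `|k|)) => y /YM; rewrite ler_norml => /andP[].
have Yu : has_ubound Y.
  by exists (M + M * `|k|) => y /YM; rewrite ler_norml => /andP[].
have Yi : has_inf Y by [].
have Ys : has_sup Y by [].
have dotY z : K z -> n.1 * inf Y <= dot z n <= n.1 * sup Y.
  move=> Kz; have Yz := KY _ Kz.
  have -> : dot z n = n.1 * (z.1 + z.2 * k).
    by rewrite /dot /k; field; rewrite gt_eqF.
  by rewrite !ler_pM2l// ge_inf// ub_le_sup.
have SY y : inf Y < y < sup Y -> S y !=set0.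
  move=> /andP[iy ys].
  have [y1 [r1 S1] y1y] := inf_lt Y0 iy.
  have [y2 [r2 S2] yy2] := sup_gt Y0 ys.
  have y12 : 0 < y2 - y1 by rewrite subr_gt0; lra.
  have := Sconv _ _ _ _ ((y - y1) / (y2 - y1)) S1 S2.
  rewrite (_ : _ + _ * y2 = y); last by field; rewrite gt_eqF.
  move=> H; eexists; apply: H; apply/andP; split; first by rewrite divr_ge0//; lra.
  by rewrite ler_pdivrMr//; lra.
(* A difference of second coordinates on a slice becomes a tangential distance; [n] being a unit
   vector is what leaves the single factor [n.1]. *)
have perpE x y t : (y - x) / n.1 =
    dot (t - y * k, y) (perp n) - dot (t - x * k, x) (perp n).
  rewrite /dot /perp /k/=.
  have -> : (y - x) / n.1 = (y - x) * (n.1 ^+ 2 + n.2 ^+ 2) / n.1 by rewrite n1 mulr1.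
  by field; rewrite gt_eqF.
have := @normr_Rintegral_antiperiodic R f (fun t => g (n.1 * t)) (h / n.1)
  (inf Y) (sup Y) (n.1 * W).
rewrite (_ : 4 * (h / n.1) * (n.1 * W) = 4 * h * W); last first.
  by field; rewrite gt_eqF.
apply => //.
- by rewrite divr_gt0.
- by case: Y0 => y Yy; exact: le_trans (ge_inf Yl Yy) (ub_le_sup Yu Yy).
- by move=> t; rewrite fine_ge0.
- move=> t ta; apply: f0E => St.
  by have := ge_inf Yl (St : Y t); rewrite leNgt ta.
- move=> t tb; apply: f0E => St.
  by have := ub_le_sup Yu (St : Y t); rewrite leNgt tb.
- move=> t /andP[_ ta]; rewrite -lee_fin -SE.
  have ta' : n.1 * t <= n.1 * inf Y + 2 * h.
    rewrite (_ : _ + _ = n.1 * (inf Y + 2 * (h / n.1))) ?ler_pM2l//.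
    by field; rewrite gt_eqF.
  apply: lebesgue_measure_le_diam; last by rewrite mulr_ge0// ltW.
  have capS r : S t r -> cap K n (2 * h) (t - r * k, r).
    move=> Sr; split => // z /dotY/andP[z1 _]; rewrite dotS//; lra.
  move=> x y /capS Sx /capS Sy; have := capn _ _ Sx Sy.
  by rewrite -perpE ler_pdivrMr// mulrC.
- move=> t /andP[tb _]; rewrite -lee_fin -SE.
  have tb' : n.1 * sup Y - 2 * h <= n.1 * t.
    rewrite (_ : _ - _ = n.1 * (sup Y - 2 * (h / n.1))) ?ler_pM2l//.
    by field; rewrite gt_eqF.
  apply: lebesgue_measure_le_diam; last by rewrite mulr_ge0// ltW.
  have dotN (z : R * R) : dot z (- n) = - dot z n by rewrite /dot/=; ring.
  have perpN (z : R * R) : dot z (perp (- n)) = - dot z (perp n).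
    by rewrite /dot /perp/=; ring.
  have capS r : S t r -> cap K (- n) (2 * h) (t - r * k, r).
    move=> Sr; split => // z /dotY/andP[_ z1]; rewrite !dotN dotS//; lra.
  move=> x y /capS Sx /capS Sy; have := capN _ _ Sy Sx.
  by rewrite !perpN opprK addrC -perpE ler_pdivrMr// mulrC.
- move=> t ta tb.
  (* Concavity of the section length: midpoints of points in the two outer sections lie in the
     middle one, so the supremum of a section is midpoint concave and the infimum midpoint convex.
     The strict inequalities on [t] make all three sections nonempty. *)
  have hc0 : 0 < h / n.1 by rewrite divr_gt0.
  have S1 : S t !=set0 by apply: SY; apply/andP; split; lra.
  have S2 : S (t + 2 * (h / n.1)) !=set0 by apply: SY; apply/andP; split; lra.
  have S3 : S (t + h / n.1) !=set0 by apply: SY; apply/andP; split; lra.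
  rewrite !fE//.
  have mid r1 r2 : S t r1 -> S (t + 2 * (h / n.1)) r2 ->
      S (t + h / n.1) ((r1 + r2) / 2).
    move=> H1 H2; have := Sconv _ _ _ _ (2^-1) H1 H2.
    rewrite (_ : _ + _ * (t + _) = t + h / n.1); last by lra.
    rewrite (_ : _ + _ * r2 = (r1 + r2) / 2); last by lra.
    by apply; apply/andP; split; lra.
  have : sup (S t) <= 2 * sup (S (t + h / n.1)) - sup (S (t + 2 * (h / n.1))).
    apply: sup_le_ub => // r1 H1.
    suff : sup (S (t + 2 * (h / n.1))) <= 2 * sup (S (t + h / n.1)) - r1 by lra.
    apply: sup_le_ub => // r2 H2.
    have := ub_le_sup (Su _) (mid _ _ H1 H2); lra.
  have : 2 * inf (S (t + h / n.1)) - inf (S (t + 2 * (h / n.1))) <= inf (S t).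
    apply: lb_le_inf => // r1 H1.
    suff : 2 * inf (S (t + h / n.1)) - r1 <= inf (S (t + 2 * (h / n.1))) by lra.
    apply: lb_le_inf => // r2 H2.
    have := ge_inf (Sl _) (mid _ _ H1 H2); lra.
  lra.
- by apply: measurableT_comp => //; exact: measurable_funM.
- move=> t; rewrite (_ : n.1 * (t + h / n.1) = n.1 * t + h) ?gh//.
  by field; rewrite gt_eqF.
Qed.

(** Reflection in the diagonal preserves area, by integrating in the two orders; it serves the case
    [n.1 = 0], where slices cannot be parameterized by the second coordinate. *)
Lemma Rintegral_swap (K : set (R * R)) (M : R) (n : R * R) (g : R -> R) :
  measurable K -> K `<=` square M ->
  measurable_fun setT g -> (forall t, `|g t| <= 1) ->
  \int[mu2]_(x in K) g (dot x n) =
  \int[mu2]_(x in (fun z => (z.2, z.1)) @^-1` K) g (dot x (n.2, n.1)).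
Proof.
move=> mK KM mg g1.
have mdot (m : R * R) : measurable_fun setT (fun z => g (dot z m)).
  apply: (measurableT_comp mg).
  exact: (measurable_funD (measurable_funM measurable_fst (measurable_cst _))
    (measurable_funM measurable_snd (measurable_cst _))).
have int (A : set (R * R)) m : measurable A -> A `<=` square M ->
    mu2.-integrable setT (EFin \o (fun z => \1_A z * g (dot z m))).
  move=> mA AM; apply: (@integrable_square _ _ M 1) => //.
  - by apply: measurable_funM; [exact: measurable_indic|exact: mdot].
  - move=> z; rewrite normrM mulr_ile1// indicE.
    by case: (_ \in _); rewrite ?normr1 ?normr0.
  - move=> z zM; rewrite indicE memNset ?mul0r//.
    by move=> ?; apply/zM/AM.
have mK' : measurable ((fun z : R * R => (z.2, z.1)) @^-1` K).
  have : measurable_fun setT (fun z : R * R => (z.2, z.1)).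
    by apply/measurable_fun_pairP; split => /=;
      [exact: measurable_snd|exact: measurable_fst].
  by move=> /(_ measurableT _ mK); rewrite setTI.
have KM' : (fun z : R * R => (z.2, z.1)) @^-1` K `<=` square M.
  by move=> z /KM[].
have E (A : set (R * R)) m : \int[mu2]_(x in A) g (dot x m) =
    fine (\int[mu2]_z (\1_A z * g (dot z m))%:E)%E.
  rewrite Rintegral_mkcond /Rintegral; congr fine.
  apply: eq_integral => z _; rewrite patchE indicE.
  by case: ifP => _ /=; rewrite ?mul1r ?mul0r.
rewrite !E -[in LHS](integral21_prod_meas1 (int _ _ mK KM)).
congr fine; rewrite -[RHS](integral12_prod_meas1 (int _ _ mK' KM')).
apply: eq_integral => y _; rewrite /fubini_F /fubini_G; apply: eq_integral => r _.
by rewrite /= !indicE /dot/= [_ * n.2 + _]addrC.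
Qed.

Lemma normr_Rintegral_cap (K : set (R * R)) (M : R) (n : R * R)
    (g : R -> R) (h W : R) :
  measurable K -> K `<=` square M -> plane_convex K -> K !=set0 ->
  n.1 ^+ 2 + n.2 ^+ 2 = 1 -> 0 < h -> 0 <= W ->
  measurable_fun setT g -> (forall t, `|g t| <= 1) ->
  (forall t, g (t + h) = - g t) ->
  cap_width_le K n (2 * h) W -> cap_width_le K (- n) (2 * h) W ->
  `|\int[mu2]_(x in K) g (dot x n)| <= 4 * h * W.
Proof.
have pos (K' : set (R * R)) (n' : R * R) : n'.1 != 0 ->
  measurable K' -> K' `<=` square M -> plane_convex K' -> K' !=set0 ->
  n'.1 ^+ 2 + n'.2 ^+ 2 = 1 -> 0 < h -> 0 <= W ->
  measurable_fun setT g -> (forall t, `|g t| <= 1) ->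
  (forall t, g (t + h) = - g t) ->
  cap_width_le K' n' (2 * h) W -> cap_width_le K' (- n') (2 * h) W ->
  `|\int[mu2]_(x in K') g (dot x n')| <= 4 * h * W.
  case: (ltgtP n'.1 0) => // n0 _ mK KM cK K0 n1 h0 W0 mg g1 gh W1 W2; last first.
    exact: (@normr_Rintegral_cap_pos _ M).
  (* For negative first coordinate, both the normal and the argument of [g] change sign, and the two
     caps are exchanged. *)
  have -> : \int[mu2]_(x in K') g (dot x n') =
      \int[mu2]_(x in K') (g \o -%R) (dot x (- n')).
    apply: eq_Rintegral => x _; have -> // : dot x n' = - dot x (- n').
    by rewrite /dot/=; ring.
  apply: (@normr_Rintegral_cap_pos K' M (- n') (g \o -%R)) => //=.
  - by rewrite oppr_gt0.
  - by rewrite !sqrrN.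
  - exact: measurableT_comp.
  - by move=> t; rewrite (_ : - t = - (t + h) + h) ?gh ?opprK//; ring.
  - by rewrite opprK.
have [n10 mK KM cK K0|n10] := eqVneq n.1 0; last exact: pos.
rewrite n10 expr0n/= add0r => n21 h0 W0 mg g1 gh W1 W2.
rewrite (Rintegral_swap _ mK KM)//.
(* The reflection reverses orientation, hence the sign of the tangential coordinate: [p] and [q]
   exchange their roles. *)
have capE (m : R * R) : m.1 = 0 -> cap_width_le K m (2 * h) W ->
    cap_width_le ((fun z => (z.2, z.1)) @^-1` K) (m.2, m.1) (2 * h) W.
  move=> m10 mW p q [Kp cp] [Kq cq].
  have dotE (z : R * R) : dot z (m.2, m.1) = dot (z.2, z.1) m.
    by rewrite /dot/=; ring.
  have cap1 (z : R * R) : K (z.2, z.1) ->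
    (forall y : R * R, K (y.2, y.1) -> dot z (m.2, m.1) <= dot y (m.2, m.1) + 2 * h) ->
    cap K m (2 * h) (z.2, z.1).
    move=> Kz cz; split => // -[y1 y2] Ky; have := cz (y2, y1) Ky.
    by rewrite !dotE.
  have := mW _ _ (cap1 _ Kq cq) (cap1 _ Kp cp).
  by rewrite /dot /perp/=; lra.
apply: pos => //.
- by apply: contra_eq_neq n21 => /= ->; rewrite expr0n/= eq_sym oner_neq0.
- have : measurable_fun setT (fun z : R * R => (z.2, z.1)).
    by apply/measurable_fun_pairP; split => /=;
      [exact: measurable_snd|exact: measurable_fst].
  by move=> /(_ measurableT _ mK); rewrite setTI.
- by move=> z /KM[].
- by move=> p q t Kp Kq t01; exact: (cK _ _ t Kp Kq t01).
- by case: K0 => -[x y] Kxy; exists (y, x).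
- by rewrite /= n10 expr0n/= addr0.
- exact: capE.
- by have := capE (- n); apply=> //=; rewrite n10 oppr0.
Qed.

End cap_bound.

(** * Geometry of caps *)

Section geometry.
Context {R : realType}.
Implicit Types (K : set (R * R)) (n p q z w : R * R).

Lemma dotBl p q n : dot (p - q) n = dot p n - dot q n.
Proof. by rewrite /dot/=; ring. Qed.

Lemma unit_u (t : R) : (u t).1 ^+ 2 + (u t).2 ^+ 2 = 1.
Proof. exact: cos2Dsin2. Qed.

Lemma unit_perp n : n.1 ^+ 2 + n.2 ^+ 2 = 1 ->
  (perp n).1 ^+ 2 + (perp n).2 ^+ 2 = 1.
Proof. by rewrite /perp/= sqrrN addrC. Qed.

(** Cauchy-Schwarz, from Lagrange's identity: the difference of the squares is the square of a
    determinant. *)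
Lemma dot_unit_le n z : n.1 ^+ 2 + n.2 ^+ 2 = 1 -> `|dot z n| <= enorm z.
Proof.
move=> n1; rewrite -sqrtr_sqr /enorm ler_sqrt; last first.
  by rewrite /dot addr_ge0// -expr2 sqr_ge0.
rewrite -subr_ge0 (_ : _ - _ = (z.1 * n.2 - z.2 * n.1) ^+ 2) ?sqr_ge0//.
have -> : dot z z = dot z z * (n.1 ^+ 2 + n.2 ^+ 2) by rewrite n1 mulr1.
by rewrite /dot; ring.
Qed.

Lemma unit_le1 n : n.1 ^+ 2 + n.2 ^+ 2 = 1 -> `|n.1| <= 1 /\ `|n.2| <= 1.
Proof.
move=> n1; split.
  by rewrite -ler_sqr ?nnegrE// expr1n real_normK ?num_real// -n1 lerDl sqr_ge0.
by rewrite -ler_sqr ?nnegrE// expr1n real_normK ?num_real// -n1 lerDr sqr_ge0.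
Qed.

(** By the mean value theorem sin x = x cos c with 0 < c < 1, and cos c = 1 - 2 sin(c/2)^2 is at
    least 1/2 because sin(c/2) is at most c/2. *)
Lemma sin_ge_half (x : R) : 0 <= x <= 1 -> x / 2 <= sin x.
Proof.
have sin_le (y : R) : 0 <= y -> sin y <= y.
  rewrite le_eqVlt => /predU1P[<-|y0]; first by rewrite sin0.
  have [|c _] := @MVT R sin cos 0 y y0 (fun x _ => is_derive_sin x).
    by apply: continuous_subspaceT => z; exact: continuous_sin.
  by rewrite sin0 !subr0 => ->; rewrite ler_piMl ?cos_le1// ltW.
move=> /andP[]; rewrite le_eqVlt => /predU1P[<-|x0 x1]; first by rewrite sin0 mul0r.
have [|c] := @MVT R sin cos 0 x x0 (fun x _ => is_derive_sin x).
  by apply: continuous_subspaceT => z; exact: continuous_sin.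
rewrite in_itv/= sin0 !subr0 => /andP[c0 cx] ->.
rewrite mulrC ler_wpM2r//; first exact: ltW.
have -> : cos c = 1 - 2 * sin (c / 2) ^+ 2.
  have {1}-> : c = c / 2 + c / 2 by lra.
  rewrite cosD; have := cos2Dsin2 (c / 2); rewrite !expr2 => H.
  have : cos (c / 2) * cos (c / 2) = 1 - sin (c / 2) * sin (c / 2) by lra.
  by move=> ->; ring.
have s1 : sin (c / 2) <= c / 2 by apply: sin_le; lra.
have s0 : 0 <= sin (c / 2).
  by apply: sin_ge0_pi; have := @pi_ge2 R => ?; apply/andP; split; lra.
have : sin (c / 2) ^+ 2 <= 4^-1.
  have -> : (4^-1 : R) = 2^-1 ^+ 2 by field.
  by rewrite ler_sqr ?nnegrE//; lra.
lra.
Qed.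

Lemma u_rotate (t t' : R) z :
  dot z (u t') = cos (t' - t) * dot z (u t) + sin (t' - t) * dot z (perp (u t)).
Proof.
have [s ->] : exists s, t' = s + t by exists (t' - t); ring.
by rewrite addrK /u /dot/= cosD sinD; ring.
Qed.

(** Moving from [w] in the direction opposite to [n], the last point of [K] exists because [K] is
    closed and bounded. It is not interior, since otherwise the ray would stay in [K] a little
    longer. *)
Lemma bottom_point K (M : R) n w : closed K -> K `<=` square M ->
  n.1 ^+ 2 + n.2 ^+ 2 = 1 -> K w ->
  exists z, [/\ K z, ~ (K°) z, dot z n <= dot w n & dot z (perp n) = dot w (perp n)].
Proof.
move=> cK KM n1 Kw; have [n11 n21] := unit_le1 n1.
pose ray (l : R) : R * R := (w.1 - l * n.1, w.2 - l * n.2).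
pose A := [set l | 0 <= l /\ K (ray l)].
have A0 : A 0 by split => //; rewrite /ray !mul0r !subr0 -surjective_pairing.
have dray l : dot (ray l) n = dot w n - l.
  rewrite /dot /ray/= -[X in _ = _ - X]mulr1 -n1; ring.
have Aub : has_ubound A.
  exists (dot w n + 2 * M) => l [l0 /KM[]]; rewrite /square/= !in_itv/=.
  move=> /andP[a1 a2] /andP[b1 b2].
  have : `|dot (ray l) n| <= 2 * M.
    rewrite (_ : 2 * M = M + M); last by ring.
    rewrite /dot (le_trans (ler_normD _ _))// lerD//.
      by rewrite normrM -[leRHS]mulr1 ler_pM// ler_norml; apply/andP.
    by rewrite normrM -[leRHS]mulr1 ler_pM// ler_norml; apply/andP.
  by rewrite dray ler_norml => /andP[? ?]; lra.
have As : has_sup A by split => //; exists 0.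
pose l0 := sup A.
have l00 : 0 <= l0 by exact: ub_le_sup.
have near_ray (l m e : R) : `|l - m| < e -> ball (ray l) e (ray m).
  move=> lme; split; rewrite /ball/=.
    rewrite (_ : _ - _ = (m - l) * n.1); last by ring.
    by rewrite normrM distrC (le_lt_trans _ lme)// ler_piMr.
  rewrite (_ : _ - _ = (m - l) * n.2); last by ring.
  by rewrite normrM distrC (le_lt_trans _ lme)// ler_piMr.
exists (ray l0); split.
- apply: cK => B /nbhs_ballP[e /= e0 eB].
  have [l [l1 Kl] ll] := sup_adherent e0 As.
  exists (ray l); split => //; apply: eB; apply: near_ray.
  have : l <= l0 by exact: ub_le_sup.
  by rewrite -/l0 in ll => ?; rewrite ger0_norm; lra.
- move=> /nbhs_ballP[e /= e0 eK].
  have : A (l0 + e / 2).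
    split; first lra.
    apply: eK; apply: near_ray; rewrite opprD addNKr normrN ger0_norm; lra.
  by move/(ub_le_sup Aub); rewrite -/l0; lra.
- by rewrite dray; lra.
- by rewrite /dot /perp /ray/=; ring.
Qed.

(** The segment from [p] to [q] stays in the cap by convexity and meets the tangential coordinate
    [x]; dropping from there to the boundary only decreases the height. *)
Lemma cap_boundary_point K (M d x : R) n p q : closed K -> K `<=` square M ->
  plane_convex K -> n.1 ^+ 2 + n.2 ^+ 2 = 1 -> cap K n d p -> cap K n d q ->
  dot p (perp n) <= x <= dot q (perp n) ->
  exists z, [/\ cap K n d z, ~ (K°) z & dot z (perp n) = x].
Proof.
move=> cK KM convK n1 [Kp cp] [Kq cq] /andP[px xq].
have [t t01 tx] : exists2 t, 0 <= t <= 1 &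
    (1 - t) * dot p (perp n) + t * dot q (perp n) = x.
  have [pq|pq] := eqVneq (dot p (perp n)) (dot q (perp n)).
    by exists 0; [rewrite lexx ler01 | lra].
  have pq0 : 0 < dot q (perp n) - dot p (perp n) by rewrite subr_gt0 lt_neqAle pq; lra.
  exists ((x - dot p (perp n)) / (dot q (perp n) - dot p (perp n))).
    apply/andP; split; first by rewrite divr_ge0//; lra.
    by rewrite ler_pdivrMr//; lra.
  by field; rewrite gt_eqF.
pose w := ((1 - t) * p.1 + t * q.1, (1 - t) * p.2 + t * q.2).
have [z [Kz Iz zn zp]] := bottom_point cK KM n1 (convK _ _ _ Kp Kq t01 : K w).
have wE m : dot w m = (1 - t) * dot p m + t * dot q m by rewrite /dot /w/=; ring.
exists z; split => //; last by rewrite zp wE.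
split => // y Ky; apply: (le_trans zn); rewrite wE.
have /andP[t0 t1] := t01.
have : (1 - t) * dot p n <= (1 - t) * (dot y n + d) by rewrite ler_wpM2l ?cp//; lra.
have : t * dot q n <= t * (dot y n + d) by rewrite ler_wpM2l ?cq.
lra.
Qed.

(* Turning the normal by [t' - t] lowers by [sin |t' - t|] times its tangential distance
   to [y] one of the two points [p], [q]; but [y] stays almost lowest. *)
Lemma cap_angle_le K (t t' d l : R) y p q : 0 <= d -> 0 <= l -> `|t - t'| <= 1 ->
  cap K (u t) (2 * d) y -> cap K (u t') (2 * d) y ->
  cap K (u t) d p -> cap K (u t) d q ->
  l <= dot y (perp (u t)) - dot p (perp (u t)) ->
  l <= dot q (perp (u t)) - dot y (perp (u t)) ->
  `|t - t'| * l <= 6 * d.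
Proof.
move=> d0 l0 tt [Ky cy] [_ cy'] [Kp cp] [Kq cq] lp lq.
have c1 := cos_le1 (t' - t); have cN1 := cos_geN1 (t' - t).
(* The bound [3 * d] is [2 * d] for the depth of [y] in the turned cap plus [d] for the height of
   [r] above [y]; the estimate of the sine by half the angle turns it into [6 * d]. *)
have half (r : R * R) : K r -> dot r (u t) <= dot y (u t) + d ->
    sin (t' - t) * (dot y (perp (u t)) - dot r (perp (u t))) <= 3 * d.
  move=> Kr hr; have := cy' _ Kr; rewrite !(u_rotate t t').
  have c0 : 0 <= cos (t' - t).
    apply: cos_ge0_pihalf; have := @pi_ge2 R => ?.
    by move: tt; rewrite distrC ler_norml => /andP[? ?]; apply/andP; split; lra.
  have : cos (t' - t) * (dot r (u t) - dot y (u t)) <= 1 * d.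
    have [H|H] := leP 0 (dot r (u t) - dot y (u t)); first by rewrite ler_pM//; lra.
    apply: (@le_trans _ _ 0); last lra.
    by rewrite mulr_ge0_le0// ltW.
  lra.
have [tt'|tt'] := leP t t'.
  rewrite distrC ger0_norm ?subr_ge0//.
  have := half _ Kp (cp _ Ky).
  have : (t' - t) / 2 * l <= sin (t' - t) * (dot y (perp (u t)) - dot p (perp (u t))).
    apply: ler_pM => //; first lra.
    by apply: sin_ge_half; move: tt; rewrite distrC ler_norml => /andP[? ?]; apply/andP; split; lra.
  lra.
rewrite gtr0_norm ?subr_gt0//.
have := half _ Kq (cq _ Ky).
have : (t - t') / 2 * l <= sin (t - t') * (dot q (perp (u t)) - dot y (perp (u t))).
  apply: ler_pM => //; first lra.
  by apply: sin_ge_half; move: tt; rewrite ler_norml => /andP[? ?]; apply/andP; split; lra.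
by rewrite -[t' - t]opprB sinN; lra.
Qed.

End geometry.

(** * Measurable majorants *)

Section dominated.
Context {R : realType}.
Local Notation mu := (@lebesgue_measure R).

(* For nonmeasurable [phi] the library integral is a lower integral, hence not subadditive:
   measurable majorants are. *)
Definition dominated (I : set R) (phi : R -> R) (B : R) :=
  exists F : R -> R, [/\ measurable_fun setT F, forall x, 0 <= F x,
    forall x, I x -> phi x <= F x & (\int[mu]_x (F x)%:E <= B%:E)%E].

Lemma dominated_le (I : set R) (phi psi : R -> R) (B B' : R) :
  dominated I psi B -> (forall x, I x -> phi x <= psi x) -> B <= B' ->
  dominated I phi B'.
Proof.
move=> [F [mF F0 pF iF]] pp BB; exists F; split => //.
  by move=> x Ix; exact: le_trans (pp _ Ix) (pF _ Ix).
by rewrite (le_trans iF)// lee_fin.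
Qed.

Lemma dominatedD (I : set R) (phi psi : R -> R) (B B' : R) :
  dominated I phi B -> dominated I psi B' ->
  dominated I (fun x => phi x + psi x) (B + B').
Proof.
move=> [F [mF F0 pF iF]] [G [mG G0 pG iG]]; exists (fun x => F x + G x); split.
- exact: measurable_funD.
- by move=> x; rewrite addr_ge0.
- by move=> x Ix; rewrite lerD ?pF ?pG.
- under eq_integral do rewrite EFinD.
  rewrite ge0_integralD//; first by rewrite EFinD leeD.
  + by move=> x _; rewrite lee_fin.
  + exact/measurable_EFinP.
  + by move=> x _; rewrite lee_fin.
  + exact/measurable_EFinP.
Qed.

Lemma dominatedZ (I : set R) (phi : R -> R) (c B : R) : 0 <= c ->
  dominated I phi B -> dominated I (fun x => c * phi x) (c * B).
Proof.
move=> c0 [F [mF F0 pF iF]]; exists (fun x => c * F x); split.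
- exact: measurable_funM.
- by move=> x; rewrite mulr_ge0.
- by move=> x Ix; rewrite ler_wpM2l ?pF.
- under eq_integral do rewrite EFinM.
  rewrite ge0_integralZl//; first by rewrite EFinM lee_wpmul2l.
  + exact/measurable_EFinP.
  + by move=> x _; rewrite lee_fin.
Qed.

Lemma dominated_itv (I : set R) (a b c : R) (phi : R -> R) :
  0 <= c -> a <= b -> (forall x, I x -> phi x <= 0 \/ a <= x <= b /\ phi x <= c) ->
  dominated I phi (c * (b - a)).
Proof.
move=> c0 ab Ipc; exists (fun x => c * \1_(`[a, b]%classic : set R) x); split.
- by apply: measurable_funM => //; exact: measurable_indic.
- by move=> x; rewrite mulr_ge0// indicE ler0n.
- move=> x /Ipc[p0|[xab pc]]; first by rewrite (le_trans p0)// mulr_ge0// indicE ler0n.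
  by rewrite indicE mem_set/= ?in_itv//= mulr1.
- under eq_integral do rewrite EFinM.
  rewrite integralZl//; last exact: integrable_indic_itv.
  rewrite integral_indic//= setIT lebesgue_measure_itv/= lte_fin.
  by case: ltgtP ab => //= -> _; rewrite subrr mule0 mulr0.
Qed.

Lemma dominated0 (I : set R) (phi : R -> R) :
  (forall x, I x -> phi x <= 0) -> dominated I phi 0.
Proof.
move=> phi0; have := @dominated_itv I 0 0 0 phi; rewrite mul0r; apply => //.
by move=> x /phi0; left.
Qed.

Lemma dominated_sum (I : set R) n (phi : nat -> R -> R) (B : nat -> R) :
  (forall j, (j < n)%N -> dominated I (phi j) (B j)) ->
  dominated I (fun x => \sum_(j < n) phi j x) (\sum_(j < n) B j).
Proof.
elim: n => [_|n IH H].
  rewrite big_ord0; apply: dominated0 => x _; by rewrite big_ord0.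
rewrite big_ord_recr; under eq_fun do rewrite big_ord_recr.
apply: dominatedD; last exact: H.
by apply: IH => j jn; apply: H; rewrite ltnS ltnW.
Qed.

(** Take [c] in [T] with [phi c] more than half the supremum. All of [T] lies within [r / phi c] of
    [c], and [phi] is at most [2 * phi c] there, so a multiple of an interval indicator with
    integral [4 * r] dominates. The boolean factor makes empty [T] cost nothing, so that a sum over
    grid points counts only those that occur. *)
Lemma dominated_clustered (I T : set R) (phi : R -> R) (D r : R) :
  0 <= r -> (forall x, T x -> 0 <= phi x <= D) ->
  (forall x y, T x -> T y -> `|x - y| * phi y <= r) ->
  dominated I (fun x => if `[< T x >] then phi x else 0)
    (4 * r * `[< T !=set0 >]%:R).
Proof.
move=> r0 phiD close; case: asboolP => [T0|T0]; last first.
  rewrite mulr0; apply: dominated0 => x _; case: asboolP => // Tx.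
  by exfalso; apply: T0; exists x.
rewrite mulr1; pose V := phi @` T.
have V0 : V !=set0 by case: T0 => x Tx; exists (phi x); exists x.
have Vs : has_sup V by split => //; exists D => _ [x /phiD/andP[_ ?] <-].
have phi_sup x : T x -> phi x <= sup V.
  by move=> Tx; apply: ub_le_sup; [case: Vs|exists x].
have [s0|s0] := leP (sup V) 0.
  apply: (dominated_le (psi := fun=> 0) (B := 0)); last by rewrite mulr_ge0.
    exact: dominated0.
  by move=> x _; case: asboolP => // /phi_sup/le_trans; apply.
have s2 : 0 < sup V / 2 by lra.
have [_ [c Tc <-] cs] := sup_adherent s2 Vs.
have {}cs : sup V < 2 * phi c by move: cs; lra.
have p0 : 0 < phi c by lra.
have -> : 4 * r = (2 * phi c) * (c + r / phi c - (c - r / phi c)).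
  by field; rewrite gt_eqF.
apply: dominated_itv; [lra| |].
  have : 0 <= r / phi c by rewrite divr_ge0// ltW.
  lra.
move=> x _; case: asboolP => [Tx|]; last by left.
right; split; last by have := phi_sup _ Tx; lra.
have : `|x - c| <= r / phi c by rewrite ler_pdivlMr// close.
by rewrite ler_norml => /andP[? ?]; apply/andP; split; lra.
Qed.

End dominated.

(** * Cap widths along a grid of boundary points *)

Section grid.
Context {R : realType}.
Local Notation mu := (@lebesgue_measure R).
Variables (K : set (R * R)) (M L : R) (G : R -> R * R).
Hypotheses (cK : closed K) (KM : K `<=` square M) (convK : plane_convex K).
Hypotheses (L0 : 0 < L) (GK : forall s, K (G s)).
Hypothesis Glip : forall n s t, n.1 ^+ 2 + n.2 ^+ 2 = 1 ->
  `|dot (G s) n - dot (G t) n| <= `|s - t|.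
Hypothesis Gbd : forall z, K z -> ~ (K°) z -> exists2 s, 0 <= s < L & G s = z.

(** The parameters of boundary points in some cap with normal angle in [I]. At depth 0, for [K] the
    closure of the body, its measure is the portion of perimeter. *)
Definition cap_params (I : set R) (d : R) : set R :=
  [set s | 0 <= s < L /\ exists2 t, I t & cap K (u t) d (G s)].

Section fixed_scale.
Variables (a b d D : R) (l : R -> R) (N : nat).
Hypotheses (ab : a <= b) (ab1 : b - a <= 1) (d0 : 0 < d).
Let I : set R := `[a, b]%classic.
Hypothesis lD : forall t, I t -> 0 <= l t <= D.
Hypothesis lcap : forall t, I t -> exists p q, [/\ cap K (u t) d p, cap K (u t) d q &
  l t <= dot q (perp (u t)) - dot p (perp (u t))].
Let eta := L / N.+1%:R.
Hypothesis etad : eta <= d.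

Let eta0 : 0 < eta. Proof. by rewrite divr_gt0. Qed.

(** The angles for which the [j]-th grid point lies under the middle of the cap. Depth [2 * d] and
    the fraction 1/8 leave room for the passage from a boundary point of the cap of depth [d], a
    quarter of the width away from its ends, to the nearby grid point. *)
Let T (j : nat) : set R := [set t | [/\ I t, cap K (u t) (2 * d) (G (j%:R * eta)) &
  exists p q, [/\ cap K (u t) d p, cap K (u t) d q,
    l t / 8 <= dot (G (j%:R * eta)) (perp (u t)) - dot p (perp (u t)) &
    l t / 8 <= dot q (perp (u t)) - dot (G (j%:R * eta)) (perp (u t))]]].

Let grid_index s : 0 <= s < L ->
  exists2 j, (j < N.+1)%N & j%:R * eta <= s < j.+1%:R * eta.
Proof.
move=> /andP[s0 sL].
have se0 : 0 <= s / eta by rewrite divr_ge0// ltW.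
have /andP[j1 j2] := truncn_itv se0.
rewrite ler_pdivlMr// in j1; rewrite ltr_pdivrMr// in j2.
exists (Num.truncn (s / eta)); last by rewrite j1.
rewrite -(ltr_nat R) -(ltr_pM2r eta0) (le_lt_trans j1)//.
by rewrite /eta mulrC divfK.
Qed.

Let near_cap t s s' e e' : cap K (u t) e (G s) -> `|s' - s| <= e' ->
  cap K (u t) (e + e') (G s').
Proof.
move=> [_ cs] ss; split => // z Kz; have := cs _ Kz.
have := Glip s' s (unit_u t); rewrite ler_norml => /andP[_ ?]; lra.
Qed.

Let cell j : set R := `[j%:R * eta, j.+1%:R * eta[%classic.

Let cell_index j s : cell j s -> `|s - j%:R * eta| <= eta.
Proof.
rewrite /cell/= in_itv/= -natr1 mulrDl mul1r => /andP[? ?].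
by rewrite ger0_norm; lra.
Qed.

Let mu_cell j : mu (cell j) = eta%:E.
Proof.
rewrite lebesgue_measure_itv/= lte_fin -natr1 mulrDl mul1r ltrDl eta0.
by rewrite -EFinB; congr EFin; ring.
Qed.

Let trivIset_cell : trivIset setT cell.
Proof.
apply/trivIsetP => i j _ _; wlog ij : i j / (i < j)%N => [H|_].
  by rewrite neq_ltn => /orP[] ?; [|rewrite setIC]; apply: H => //; rewrite ltn_eqF.
rewrite -subset0 => s []; rewrite /cell/= !in_itv/= => /andP[_ si] /andP[js _].
have : i.+1%:R * eta <= j%:R * eta by rewrite ler_wpM2r ?ler_nat// ltW.
lra.
Qed.

(** The cells starting at the grid points that occur are disjoint, of length [eta], and contained in
    the set on the right: within a cell the depth grows from [2 * d] by at most [eta], hence to at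
    most [3 * d]. *)
Lemma cap_params_count : ((eta * \sum_(j < N.+1) `[< T j !=set0 >]%:R)%:E <=
  mu (cap_params I (3 * d)))%E.
Proof.
pose F j := if `[< T j !=set0 >] then cell j else set0.
have mF j : measurable (F j).
  by rewrite /F; case: ifP => _; [exact: measurable_itv|exact: measurable0].
have tF : trivIset setT F.
  apply/trivIsetP => i j _ _ ij; rewrite /F.
  case: ifP => _; last by rewrite set0I.
  case: ifP => _; last by rewrite setI0.
  by move/trivIsetP : trivIset_cell; exact.
have <- : mu (\big[setU/set0]_(j < N.+1) F j) =
    (eta * \sum_(j < N.+1) `[< T j !=set0 >]%:R)%:E.
  rewrite measure_bigsetU// mulr_sumr -sumEFin; apply: eq_bigr => j _.
  rewrite /F; case: ifP => _; first by rewrite mulr1; exact: mu_cell.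
  by rewrite mulr0; exact: measure0.
apply: le_outer_measure; rewrite -bigcup_mkord => s [j /= jN].
rewrite /F; case: asboolP => // -[t [It ct _]] cs.
split.
  move: cs; rewrite /cell/= in_itv/= => /andP[s1 s2]; apply/andP; split.
    by rewrite (le_trans _ s1)// mulr_ge0// ltW.
  rewrite (lt_le_trans s2)// /eta mulrA ler_pdivrMr// mulrC ler_pM2l//.
  by rewrite ler_nat.
exists t => //; rewrite (_ : 3 * d = 2 * d + d); last by ring.
by apply: (near_cap ct); exact: le_trans (cell_index cs) etad.
Qed.

(** The middle half of the cap has width at least [l t / 2], and intervals of length [2 * eta]
    around the grid points counted on the right cover it. *)
Lemma cap_width_count t : I t -> 8 * eta <= l t ->
  l t <= 4 * eta * \sum_(j < N.+1) `[< T j t >]%:R.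
Proof.
move=> It le8; have [p [q [cp cq lpq]]] := lcap It.
set n := u t in cp cq lpq *.
have n1 : n.1 ^+ 2 + n.2 ^+ 2 = 1 by exact: unit_u.
set tp := dot p (perp n) in lpq *; set tq := dot q (perp n) in lpq *.
pose w := (tq - tp) / 4.
pose F (j : nat) : set R := if `[< T j t >] then
  `[dot (G (j%:R * eta)) (perp n) - eta, dot (G (j%:R * eta)) (perp n) + eta]%classic
  else set0.
pose X : set R := `[tp + w, tq - w]%classic.
have cover : X `<=` \big[setU/set0]_(j < N.+1) F j.
  move=> x; rewrite /X/= in_itv/= => /andP[x1 x2].
  (* Under each [x] of the middle half there is a boundary point of the cap; its parameter is
     rounded down to the grid. The error [eta] is at most [l t / 8], which keeps the grid point that
     far from both ends. *)
  have [z [cz Iz zx]] : exists z, [/\ cap K n d z, ~ (K°) z & dot z (perp n) = x].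
    apply: (cap_boundary_point cK KM convK n1 cp cq).
    by rewrite -/tp -/tq; apply/andP; split; move: x1 x2; rewrite /w; lra.
  have [s sL Gs] := Gbd (cz.1) Iz.
  have [j jN js] := grid_index sL.
  have sj : `|j%:R * eta - s| <= eta.
    by rewrite distrC; apply: cell_index; rewrite /cell/= in_itv.
  have := Glip (j%:R * eta) s (unit_perp n1); rewrite Gs zx => H.
  have {}H := le_trans H sj.
  have Tj : T j t.
    split => //.
      rewrite (_ : 2 * d = d + d); last by ring.
      by apply: (near_cap (s := s)); [rewrite Gs|exact: le_trans sj etad].
    exists p, q; split => //; move: H; rewrite ler_norml -/n -/tp -/tq => /andP[? ?];
      move: x1 x2; rewrite /w; lra.
  rewrite -bigcup_mkord; exists j => //; rewrite /F asboolT//= in_itv/=.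
  by move: H; rewrite ler_norml => /andP[? ?]; apply/andP; split; lra.
have : (mu X <= (2 * eta * \sum_(j < N.+1) `[< T j t >]%:R)%:E)%E.
  apply: (le_trans (le_outer_measure (@lebesgue_measure R) _ _ cover)).
  apply: (le_trans (outer_measure_subadditive (@lebesgue_measure R) F N.+1)).
  rewrite mulr_sumr -sumEFin; apply: lee_sum => j _.
  rewrite /F; case: ifP => _; last by rewrite mulr0 [X in (X <= _)%E]measure0.
  rewrite [X in (X <= _)%E]lebesgue_measure_itv/= lte_fin mulr1.
  by have e0 := eta0; case: ifP => _; rewrite -?EFinB lee_fin; lra.
rewrite /X lebesgue_measure_itv/= lte_fin.
have -> : tp + w < tq - w by have e0 := eta0; rewrite /w; lra.
by rewrite -EFinB lee_fin /w; lra.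
Qed.

(** Where [l t] is at least [8 * eta], one factor of its square is replaced by [4 * eta] times the
    number of grid points under the middle half; each of these contributes an integral of at most
    [4 * (48 * d)], and 4 * 4 * 48 = 768. Elsewhere the square is at most [64 * eta ^+ 2]. *)
Lemma cap_width_dominated_scale : dominated I (fun t => l t ^+ 2)
  (64 * eta ^+ 2 * (b - a) + 768 * d * fine (mu (cap_params I (3 * d)))).
Proof.
have dd := d0; have e0 := eta0; have ab' := ab1.
have clust j : dominated I (fun t => if `[< T j t >] then l t else 0)
    (4 * (48 * d) * `[< T j !=set0 >]%:R).
  apply: (@dominated_clustered _ _ _ _ D); first lra.
    by move=> t [/lD].
  move=> t t' [It ct _] [It' ct' [p [q [cp cq lp lq]]]].
  have /andP[l0 _] := lD It'.
  (* With tangential distance [l t' / 8] the angle estimate gives [6 * d], whence the radius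
     [48 * d] of the cluster. *)
  have : `|t' - t| * (l t' / 8) <= 6 * d.
    apply: (cap_angle_le _ _ _ ct' ct cp cq lp lq); [lra|lra|].
    move: It It'; rewrite /I/= !in_itv/= => /andP[? ?] /andP[? ?].
    by rewrite ler_norml; apply/andP; split; lra.
  rewrite distrC; lra.
have S1 := dominated_sum (n := N.+1) (fun j _ => clust j).
have S2 := dominatedZ (ltW (mulr_gt0 (ltr0Sn R 3) eta0)) S1.
have S3 : dominated I (fun=> 64 * eta ^+ 2) (64 * eta ^+ 2 * (b - a)).
  apply: dominated_itv => //; first by rewrite mulr_ge0// sqr_ge0.
  by move=> x; rewrite /I/= in_itv/= => ?; right.
apply: (dominated_le (dominatedD S3 S2)) => [t It|]; last first.
  rewrite lerD2l -mulr_sumr.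
  rewrite (_ : _ * _ = 768 * d * (eta * \sum_(j < N.+1) `[< T j !=set0 >]%:R)); last by ring.
  apply: ler_wpM2l; first lra.
  rewrite -lee_fin fineK; first exact: cap_params_count.
  rewrite ge0_fin_numE//; apply: (@le_lt_trans _ _ (mu `[0, L]%classic)).
    by apply: le_outer_measure => s [/andP[s0 sL] _]/=; rewrite in_itv/= s0 ltW.
  by rewrite lebesgue_measure_itv/= lte_fin L0 -EFinB ltry.
have /andP[l0 _] := lD It.
have sum0 : 0 <= 4 * eta * \sum_(j < N.+1) (if `[< T j t >] then l t else 0).
  rewrite mulr_ge0//; first by rewrite mulr_ge0// ltW.
  by apply: sumr_ge0 => j _; case: ifP.
have [l8|l8] := leP (8 * eta) (l t); last first.
  apply: ler_wpDr => //.
  rewrite (_ : 64 * _ = (8 * eta) ^+ 2); last by ring.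
  by rewrite ler_sqr ?nnegrE// ltW// (le_lt_trans l0).
apply: ler_wpDl; first by rewrite mulr_ge0// sqr_ge0.
rewrite (_ : \sum_(j < N.+1) _ = (\sum_(j < N.+1) `[< T j t >]%:R) * l t); last first.
  by rewrite mulr_suml; apply: eq_bigr => j _; case: ifP; rewrite ?mul1r ?mul0r.
by rewrite mulrA expr2 ler_wpM2r// cap_width_count.
Qed.

End fixed_scale.

End grid.

(** * Squared cap widths over angle intervals of arbitrary length *)

Section width.
Context {R : realType}.
Local Notation mu := (@lebesgue_measure R).

Lemma dominated_restrict (J I : set R) (phi : R -> R) (B : R) :
  dominated J phi B -> dominated I (fun t => if `[< J t >] then phi t else 0) B.
Proof.
move=> [F [mF F0 pF iF]]; exists F; split => // x _.
by case: asboolP => // Jx; exact: pF.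
Qed.

Lemma itv_subdivision (a b t : R) (m : nat) : a < b -> a <= t <= b ->
  exists2 k, (k < m.+1)%N &
    a + k%:R * ((b - a) / m.+1%:R) <= t <= a + k.+1%:R * ((b - a) / m.+1%:R).
Proof.
move=> ab /andP[a_t tb]; set w := _ / _.
have w0 : 0 < w by rewrite divr_gt0// subr_gt0.
have mw : m.+1%:R * w = b - a by rewrite /w mulrC divfK.
move: tb; rewrite le_eqVlt => /predU1P[->|tb].
  exists m => //; apply/andP; split; last by rewrite mw; lra.
  by move: mw; rewrite -natr1 mulrDl mul1r; lra.
have t0 : 0 <= (t - a) / w by rewrite divr_ge0//; [lra|exact: ltW].
have /andP[k1 k2] := truncn_itv t0.
rewrite ler_pdivlMr// in k1; rewrite ltr_pdivrMr// in k2.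
exists (Num.truncn ((t - a) / w)); last by apply/andP; split; lra.
by rewrite -(ltr_nat R) -(ltr_pM2r w0) mw; lra.
Qed.

Variables (K : set (R * R)) (M L : R) (G : R -> R * R).
Hypotheses (cK : closed K) (KM : K `<=` square M) (convK : plane_convex K).
Hypotheses (L0 : 0 < L) (GK : forall s, K (G s)).
Hypothesis Glip : forall n s t, n.1 ^+ 2 + n.2 ^+ 2 = 1 ->
  `|dot (G s) n - dot (G t) n| <= `|s - t|.
Hypothesis Gbd : forall z, K z -> ~ (K°) z -> exists2 s, 0 <= s < L & G s = z.

Lemma cap_params_fin (I : set R) d : (mu (cap_params K L G I d) < +oo)%E.
Proof.
apply: (@le_lt_trans _ _ (mu `[0, L]%classic)).
  by apply: le_outer_measure => s [/andP[s0 sL] _]/=; rewrite in_itv/= s0 ltW.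
by rewrite lebesgue_measure_itv/= lte_fin L0 -EFinB ltry.
Qed.

Lemma cap_params_le (I J : set R) d : I `<=` J ->
  fine (mu (cap_params K L G I d)) <= fine (mu (cap_params K L G J d)).
Proof.
move=> IJ; apply: fine_le.
- by rewrite ge0_fin_numE//; exact: cap_params_fin.
- by rewrite ge0_fin_numE//; exact: cap_params_fin.
- by apply: le_outer_measure => s [sL [t It ct]]; split => //; exists t => //; exact: IJ.
Qed.

(** The angle estimate concerns angles at distance at most 1, so the interval is cut into [m.+1]
    equal pieces. Each piece is charged the boundary parameters of the whole interval, and the grid
    is refined until the error term drops below [e]. *)
Lemma cap_width_dominated (a b d D e : R) (l : R -> R) (m : nat) :
  a < b -> b - a <= m.+1%:R -> 0 < d -> 0 < e ->
  (forall t, a <= t <= b -> 0 <= l t <= D) ->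
  (forall t, a <= t <= b -> exists p q, [/\ cap K (u t) d p, cap K (u t) d q &
    l t <= dot q (perp (u t)) - dot p (perp (u t))]) ->
  dominated `[a, b]%classic (fun t => l t ^+ 2)
    (m.+1%:R * (768 * d * fine (mu (cap_params K L G `[a, b]%classic (3 * d)))) + e).
Proof.
move=> ab abm d0 e0 lD lcap.
(* A step [eta] below [r] is at most [d], as the estimate at fixed scale requires; the other two
   bounds give [64 * eta ^+ 2 * (b - a) <= e]. *)
pose r : R := Num.min (Num.min d 1) (e / (64 * (b - a))).
have ba0 : 0 < 64 * (b - a) by lra.
have r0 : 0 < r by rewrite !lt_min d0 ltr01/= divr_gt0.
have [N NP] : exists N : nat, L / N.+1%:R < r.
  have [N NP] := natSinv_lt (divr_gt0 r0 L0).
  by exists N; rewrite mulrC -ltr_pdivlMr.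
set eta := L / N.+1%:R in NP.
have eta0 : 0 < eta by rewrite divr_gt0.
have [etad eta1 etae] : [/\ eta <= d, eta <= 1 & eta <= e / (64 * (b - a))].
  by move: (ltW NP); rewrite !le_min => /andP[/andP[? ?] ?].
rewrite ler_pdivlMr// in etae.
have etae2 : 64 * eta ^+ 2 * (b - a) <= e.
  rewrite (le_trans _ etae)// expr2.
  have : eta * eta * (64 * (b - a)) <= eta * 1 * (64 * (b - a)).
    by rewrite ler_wpM2r ?ler_wpM2l// ltW.
  lra.
pose w := (b - a) / m.+1%:R.
have w0 : 0 < w by rewrite divr_gt0// subr_gt0.
have mw : m.+1%:R * w = b - a by rewrite /w mulrC divfK.
have w1 : w <= 1 by rewrite ler_pdivrMr// mul1r.
pose I k : set R := `[a + k%:R * w, a + k.+1%:R * w]%classic.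
have wk k : a + k.+1%:R * w = a + k%:R * w + w by rewrite -natr1; ring.
have sub k : (k < m.+1)%N -> forall t, I k t -> a <= t <= b.
  move=> km t; rewrite /I/= in_itv/= => /andP[t1 t2].
  have : 0 <= k%:R * w by rewrite mulr_ge0// ltW.
  have : k.+1%:R * w <= m.+1%:R * w by rewrite ler_wpM2r ?ler_nat// ltW.
  by rewrite mw => ? ?; apply/andP; split; lra.
have piece k : (k < m.+1)%N -> dominated `[a, b]%classic
    (fun t => if `[< I k t >] then l t ^+ 2 else 0)
    (64 * eta ^+ 2 * w +
     768 * d * fine (mu (cap_params K L G `[a, b]%classic (3 * d)))).
  move=> km; apply: dominated_restrict.
  have := @cap_width_dominated_scale R K M L G cK KM convK L0 GK Glip Gbd
    (a + k%:R * w) (a + k.+1%:R * w) d D l N.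
  rewrite -/eta -/(I k); move=> H.
  apply: dominated_le (H _ _ d0 _ _ etad) _ _ => //.
  - by rewrite wk; lra.
  - by rewrite wk; lra.
  - by move=> t /(sub _ km)/lD.
  - by move=> t /(sub _ km)/lcap.
  - rewrite (_ : _ - _ = w); last by rewrite wk; ring.
    rewrite lerD2l; apply: ler_wpM2l; first lra.
    by apply: cap_params_le => t /(sub _ km)/=; rewrite in_itv.
apply: (dominated_le (dominated_sum piece)) => [t|].
  rewrite /= in_itv/= => tab; have [k km It] := itv_subdivision m ab tab.
  rewrite (bigD1 (Ordinal km))//= asboolT/=; last by rewrite /I/= in_itv.
  rewrite lerDl; apply: sumr_ge0 => j _; case: ifP => // _; exact: sqr_ge0.
rewrite big_const_ord iter_addr addr0 -[_ *+ m.+1]mulr_natl mulrDr [leLHS]addrC.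
rewrite lerD2l; apply: le_trans etae2; rewrite -mw; lra.
Qed.

End width.

(** * Closure and boundary of a convex body *)

Section body.
Context {R : realType}.
Local Notation mu := (@lebesgue_measure R).
Local Notation mu2 := (mu \x mu)%E.

Lemma bounded_sub_square (C : set (R * R)) : bounded_set C ->
  exists M, C `<=` square M.
Proof.
move=> [M [_ CM]]; exists (M + 1) => z Cz.
have : `|z| <= M + 1 by apply: (CM (M + 1)) => //; lra.
by rewrite /square/= !in_itv/= -!ler_norml prod_normE ge_max => /andP.
Qed.

Lemma closure_approx (C : set (R * R)) z e : closure C z -> 0 < e ->
  exists2 y, C y & `|y.1 - z.1| < e /\ `|y.2 - z.2| < e.
Proof.
move=> Cz e0; have [y [Cy [y1 y2]]] := Cz _ (nbhsx_ballx z e e0).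
by exists y => //; rewrite distrC [X in _ /\ X < _]distrC.
Qed.

Lemma closure_sub_square (C : set (R * R)) M : C `<=` square M ->
  closure C `<=` square M.
Proof.
move=> CM z Cz; suff H e : 0 < e -> `|z.1| <= M + e /\ `|z.2| <= M + e.
  rewrite /square/= !in_itv/= -!ler_norml.
  by split; apply/ler_addgt0Pr => e /H[].
move=> e0; have [y /CM + [y1 y2]] := closure_approx Cz e0.
rewrite /square/= !in_itv/= -!ler_norml => -[ym1 ym2].
move: y1 y2 ym1 ym2; rewrite !ltr_norml !ler_norml.
by move=> /andP[? ?] /andP[? ?] /andP[? ?] /andP[? ?]; split; apply/andP; split; lra.
Qed.

Lemma plane_convex_of_convex_set (C : set (R * R)) :
  convex_set (C : set (R^o * R^o)%type) -> plane_convex C.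
Proof.
move=> cC p q t Cp Cq /andP[t0 t1].
have s0 : 0 <= 1 - t by lra.
have s1 : 1 - t <= 1 by lra.
have := cC p q (Itv01 s0 s1) (mem_set Cp) (mem_set Cq).
rewrite inE /conv/=.
have -> // : unstable.onem (1 - t) = t by rewrite /unstable.onem; ring.
Qed.

Lemma plane_convex_closure (C : set (R * R)) :
  plane_convex C -> plane_convex (closure C).
Proof.
move=> cC p q t Cp Cq /andP[t0 t1] B /nbhs_ballP[e /= e0 eB].
have [p' Cp' [p1 p2]] := closure_approx Cp e0.
have [q' Cq' [q1 q2]] := closure_approx Cq e0.
exists ((1 - t) * p'.1 + t * q'.1, (1 - t) * p'.2 + t * q'.2); split.
  by apply: cC => //; rewrite t0.
have comb (x y x' y' : R) : `|x' - x| < e -> `|y' - y| < e ->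
    `|((1 - t) * x + t * y) - ((1 - t) * x' + t * y')| < e.
  move=> xx yy.
  have -> : ((1 - t) * x + t * y) - ((1 - t) * x' + t * y') =
     (1 - t) * (x - x') + t * (y - y') by ring.
  rewrite (le_lt_trans (ler_normD _ _))// !normrM (ger0_norm t0).
  rewrite (ger0_norm (_ : 0 <= 1 - t)); last by lra.
  rewrite distrC in xx; rewrite distrC in yy.
  have [->|tn0] := eqVneq t 0; first by rewrite subr0 mul1r mul0r addr0.
  have tp : 0 < t by rewrite lt_neqAle eq_sym tn0.
  have : t * `|y - y'| < t * e by rewrite ltr_pM2l.
  have : (1 - t) * `|x - x'| <= (1 - t) * e by apply: ler_wpM2l; [lra|exact: ltW].
  lra.
by apply: eB; split; rewrite /ball/=; apply: comb.
Qed.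

(** * The arc-length parameterization and the nullity of the boundary *)

Section param.
Variables (C : set (R * R)) (L : R) (G : R -> R * R).
Hypotheses (bC : convex_body C) (GC : arclength_param C L G).

Let L0 : 0 < L. Proof. by case: GC. Qed.

(** A chord is a polyline with one segment, hence no longer than the arc; projecting to a unit
    direction shortens it further. *)
Lemma arclength_lip n s t : n.1 ^+ 2 + n.2 ^+ 2 = 1 ->
  `|dot (G s) n - dot (G t) n| <= `|s - t|.
Proof.
move=> n1; wlog st : s t / s < t => [H|].
  have [/H//|/H|->] := ltgtP s t; last by rewrite !subrr normr0.
  by rewrite distrC [X in _ -> _ <= X]distrC.
have [_ _ _ _ /(_ s t (ltW st))] := GC.
rewrite [X in _ <= X]distrC [X in _ <= X]gtr0_norm ?subr_gt0// => cl.
rewrite distrC -dotBl (le_trans (dot_unit_le _ n1))// -lee_fin -cl.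
apply: ereal_sup_ubound; exists [:: t]; first by rewrite /itv_partition/= st eqxx.
by rewrite /polyline_length/= big_nat1.
Qed.

Lemma range_period z : range G z -> exists2 s, 0 <= s < L & G s = z.
Proof.
move=> [s _ <-]; have [_ pG _ _ _] := GC.
exists (s - (Num.floor (s / L))%:~R * L).
  have /andP[f1 f2] := floor_itv (s / L).
  rewrite ler_pdivlMr// in f1; rewrite ltr_pdivrMr// intrD mulrDl mul1r in f2.
  by apply/andP; split; lra.
case: (Num.floor (s / L)) => k.
  rewrite -pmulrn mulr_natl -[in RHS](subrK (L *+ k) s).
  by rewrite periodicn.
by rewrite NegzE mulrNz mulNr opprK -pmulrn mulr_natl periodicn.
Qed.

(** Interior points of [C] are interior to its closure, so the boundary of the closure is contained
    in [boundary C], the range of [G]. *)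
Lemma closure_boundary z : closure C z -> ~ (closure C)° z ->
  exists2 s, 0 <= s < L & G s = z.
Proof.
move=> Cz Iz; apply: range_period; have [_ _ _ -> _] := GC.
split => // Cz'; apply: Iz; apply: interiorS Cz'; exact: subset_closure.
Qed.

Lemma arc_closure s : closure C (G s).
Proof. by have [_ _ _ GE _] := GC; have [] : boundary C (G s) by rewrite -GE; exists s. Qed.

Lemma measurable_boundary : measurable (boundary C).
Proof.
apply: measurableD; first by apply: closed_measurable_plane; exact: closed_closure.
by apply: open_measurable_plane; exact: open_interior.
Qed.

(* The boundary, of length [L], is covered by [N] squares of side [2 * L / N]. *)
Lemma boundary_null : mu2 (boundary C) = 0%E.
Proof.
apply/eqP; rewrite eq_le measure_ge0 andbT; apply/lee_addgt0Pr => e e0.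
rewrite add0e.
have Le0 : 0 < 4 * L by rewrite mulr_gt0.
have [N NP] := natSinv_lt (divr_gt0 e0 (mulr_gt0 Le0 L0)).
pose eta := L / N.+1%:R.
have eta0 : 0 < eta by rewrite divr_gt0.
pose itv (x : R) : set R := `[x - eta, x + eta]%classic.
pose box j : set (R * R) :=
  itv (G (j%:R * eta)).1 `*` itv (G (j%:R * eta)).2.
have mbox j : measurable (box j) by apply: measurableX; exact: measurable_itv.
have cover : boundary C `<=` \big[setU/set0]_(j < N.+1) box j.
  have [_ _ _ <- _] := GC; move=> z /range_period[s /andP[s0 sL] <-].
  have se0 : 0 <= s / eta by rewrite divr_ge0// ltW.
  have /andP[j1 j2] := truncn_itv se0.
  rewrite ler_pdivlMr// in j1; rewrite ltr_pdivrMr// in j2.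
  set j := Num.truncn _ in j1 j2.
  have jN : (j < N.+1)%N.
    rewrite -(ltr_nat R) -(ltr_pM2r eta0) (le_lt_trans j1)//.
    by rewrite /eta mulrC divfK.
  have sj : `|s - j%:R * eta| <= eta.
    by move: j2; rewrite -natr1 mulrDl mul1r => ?; rewrite ger0_norm; lra.
  rewrite -bigcup_mkord; exists j => //.
  have H1 := @arclength_lip (1, 0) s (j%:R * eta).
  have H2 := @arclength_lip (0, 1) s (j%:R * eta).
  move: H1 H2; rewrite /dot/= expr1n expr0n/= !mulr1 !mulr0 !addr0 !add0r.
  move=> /(_ erefl)/le_trans/(_ sj) + /(_ erefl)/le_trans/(_ sj).
  rewrite !ler_norml /box /itv => /andP[? ?] /andP[? ?].
  by split; rewrite /= in_itv/=; apply/andP; split; lra.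
apply: (le_trans (content_subadditive mu2 (fun j _ => mbox j) measurable_boundary cover)).
rewrite (eq_bigr (fun=> (4 * eta ^+ 2)%:E)) => [|j _]; last first.
  have mitv x : mu (itv x) = (2 * eta)%:E.
    rewrite lebesgue_measure_itv/= lte_fin.
    have -> : x - eta < x + eta by lra.
    by rewrite -EFinB; congr EFin; ring.
  transitivity (mu (itv (G (j%:R * eta)).1) * mu (itv (G (j%:R * eta)).2))%E.
    by rewrite /box /itv [LHS]product_measure1E; [|exact: measurable_itv..].
  by rewrite !mitv -EFinM; congr EFin; ring.
rewrite sumEFin lee_fin big_const_ord iter_addr addr0 -[_ *+ N.+1]mulr_natl.
have -> : N.+1%:R * (4 * eta ^+ 2) = N.+1%:R^-1 * (4 * L * L).
  by rewrite /eta; field.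
by rewrite -ler_pdivlMr ?mulr_gt0// ltW.
Qed.
End param.

(** The integral of a nonnegative function is a supremum over simple functions below it, which is
    monotone for arbitrary sets and functions. *)
Lemma ge0_le_integral_nonmeasurable d (T : measurableType d)
    (nu : {measure set T -> \bar R}) (A B : set T) (f g : T -> \bar R) :
  (forall x, 0 <= f x)%E -> (forall x, 0 <= g x)%E -> A `<=` B ->
  (forall x, A x -> (f x <= g x)%E) ->
  (\int[nu]_(x in A) f x <= \int[nu]_(x in B) g x)%E.
Proof.
move=> f0 g0 AB fg; rewrite !ge0_integralE//.
apply: le_ereal_sup => _ [h hf <-]; exists h => // x; apply: (le_trans (hf x)).
rewrite !patchE; case: ifPn => xA; last by case: ifP.
by rewrite mem_set ?fg//; [exact: set_mem|apply: AB; exact: set_mem].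
Qed.

(** Used with [C] a convex body, between its interior and its closure. For the positive and the
    negative part, the integral over [C] is squeezed between those over [A] and [B], which agree
    because they differ by a null set. *)
Lemma Rintegral_null_sandwich d (T : measurableType d)
    (nu : {measure set T -> \bar R}) (A B C : set T) (f : T -> R) :
  measurable A -> measurable B -> A `<=` C -> C `<=` B ->
  nu (B `\` A) = 0%E -> measurable_fun setT f ->
  \int[nu]_(x in C) f x = \int[nu]_(x in B) f x.
Proof.
move=> mA mB AC CB BA mf.
have ge0E (g : T -> \bar R) : measurable_fun setT g -> (forall x, 0 <= g x)%E ->
    (\int[nu]_(x in C) g x = \int[nu]_(x in B) g x)%E.
  move=> mg g0; apply/eqP; rewrite eq_le; apply/andP; split.
    exact: ge0_le_integral_nonmeasurable.
  rewrite (ge0_negligible_integral (N := B `\` A))//; last 2 first.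
  - exact: measurableD.
  - exact: measurable_funS mg.
  apply: ge0_le_integral_nonmeasurable => // x [Bx nBA].
  by apply: AC; apply: contrapT => Ax; apply: nBA.
rewrite /Rintegral; congr fine; rewrite integralE [RHS]integralE; congr (_ - _)%E.
  by apply: ge0E => //; apply/measurable_funepos/measurable_EFinP.
by apply: ge0E => //; apply/measurable_funeneg/measurable_EFinP.
Qed.

End body.

(** * Support function and limit of the cap parameters *)

Section support.
Context {R : realType}.
Local Notation mu := (@lebesgue_measure R).

Lemma dot_square_le (M : R) (n z : R * R) : n.1 ^+ 2 + n.2 ^+ 2 = 1 ->
  square M z -> `|dot z n| <= 2 * M.
Proof.
move=> /unit_le1[n1 n2]; rewrite /square/= !in_itv/= -!ler_norml => -[z1 z2].
rewrite (_ : 2 * M = M * 1 + M * 1); last by ring.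
by rewrite /dot (le_trans (ler_normD _ _))// !normrM lerD// ler_pM.
Qed.

(** Half-planes are closed; this transfers supporting lines from a body to its closure. *)
Lemma closure_dot_ge (C : set (R * R)) (n : R * R) (c : R) :
  n.1 ^+ 2 + n.2 ^+ 2 = 1 -> (forall a, C a -> c <= dot a n) ->
  forall z, closure C z -> c <= dot z n.
Proof.
move=> /unit_le1[n1 n2] Cc z Cz; apply/ler_addgt0Pr => e e0.
have e2 : 0 < e / 2 by lra.
have [a Ca [a1 a2]] := closure_approx Cz e2.
apply: (le_trans (Cc _ Ca)).
have -> : dot a n = dot z n + ((a.1 - z.1) * n.1 + (a.2 - z.2) * n.2).
  by rewrite /dot; ring.
rewrite lerD2l (le_trans (ler_norm _))// (le_trans (ler_normD _ _))//.
have : `|(a.1 - z.1) * n.1| <= e / 2.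
  by rewrite normrM -[leRHS]mulr1 ler_pM// ltW.
have : `|(a.2 - z.2) * n.2| <= e / 2.
  by rewrite normrM -[leRHS]mulr1 ler_pM// ltW.
lra.
Qed.

Section bounded.
Variables (K : set (R * R)) (M : R).
Hypotheses (KM : K `<=` square M) (K0 : K !=set0).

Definition support (n : R * R) : R := inf [set dot z n | z in K].

Let has_inf_support (n : R * R) : n.1 ^+ 2 + n.2 ^+ 2 = 1 ->
  has_inf [set dot z n | z in K].
Proof.
move=> n1; split; first by case: K0 => z Kz; exists (dot z n); exists z.
exists (- (2 * M)) => _ [z /KM Kz <-].
by have := dot_square_le n1 Kz; rewrite ler_norml => /andP[].
Qed.

Lemma capP (n : R * R) d z : n.1 ^+ 2 + n.2 ^+ 2 = 1 -> K z ->
  cap K n d z <-> dot z n - support n <= d.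
Proof.
move=> n1 Kz; have [V0 Vl] := has_inf_support n1; split => [[_ cz]|zd].
  suff : dot z n - d <= support n by lra.
  by apply: lb_le_inf => // _ [y Ky <-]; have := cz _ Ky; lra.
split => // y Ky; have : support n <= dot y n by apply: ge_inf => //; exists y.
lra.
Qed.

Lemma cap_nonempty (n : R * R) d : n.1 ^+ 2 + n.2 ^+ 2 = 1 -> 0 < d ->
  cap K n d !=set0.
Proof.
move=> n1 d0; have [_ [z Kz <-] zd] := inf_adherent d0 (has_inf_support n1).
by exists z; apply/capP => //; move: zd; rewrite /support; lra.
Qed.

Definition cap_width (n : R * R) (d : R) : R :=
  sup [set x | exists p q, [/\ cap K n d p, cap K n d q &
    x = dot q (perp n) - dot p (perp n)]].

Let cap_dist (n : R * R) d p q : n.1 ^+ 2 + n.2 ^+ 2 = 1 ->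
  cap K n d p -> cap K n d q -> dot q (perp n) - dot p (perp n) <= 4 * M.
Proof.
move=> /unit_perp n1 [/KM Kp _] [/KM Kq _].
have := dot_square_le n1 Kp; have := dot_square_le n1 Kq.
by rewrite !ler_norml => /andP[? ?] /andP[? ?]; lra.
Qed.

Let has_sup_width (n : R * R) d : n.1 ^+ 2 + n.2 ^+ 2 = 1 -> 0 < d ->
  has_sup [set x | exists p q, [/\ cap K n d p, cap K n d q &
    x = dot q (perp n) - dot p (perp n)]].
Proof.
move=> n1 d0; split.
  by have [z cz] := cap_nonempty n1 d0; eexists; exists z, z.
by exists (4 * M) => _ [p [q [cp cq ->]]]; exact: cap_dist cp cq.
Qed.

Lemma cap_width_leP (n : R * R) d : n.1 ^+ 2 + n.2 ^+ 2 = 1 -> 0 < d ->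
  cap_width_le K n d (cap_width n d).
Proof.
move=> n1 d0 p q cp cq; apply: ub_le_sup; first by case: (has_sup_width n1 d0).
by exists p, q.
Qed.

Lemma cap_width_ge0 (n : R * R) d : n.1 ^+ 2 + n.2 ^+ 2 = 1 -> 0 < d ->
  0 <= cap_width n d.
Proof.
move=> n1 d0; have [z cz] := cap_nonempty n1 d0.
by rewrite -(subrr (dot z (perp n))); exact: cap_width_leP.
Qed.

Lemma cap_width_le4 (n : R * R) d : n.1 ^+ 2 + n.2 ^+ 2 = 1 -> 0 < d ->
  cap_width n d <= 4 * M.
Proof.
move=> n1 d0; apply: sup_le_ub; first by case: (has_sup_width n1 d0).
by move=> _ [p [q [cp cq ->]]]; exact: cap_dist cp cq.
Qed.

(** Half of a positive supremum is exceeded by some pair; when the width is 0, one point taken twice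
    serves. *)
Lemma cap_width_attained (n : R * R) d : n.1 ^+ 2 + n.2 ^+ 2 = 1 -> 0 < d ->
  exists p q, [/\ cap K n d p, cap K n d q &
    cap_width n d / 2 <= dot q (perp n) - dot p (perp n)].
Proof.
move=> n1 d0; have := cap_width_ge0 n1 d0.
rewrite le_eqVlt => /predU1P[<-|w0].
  have [z cz] := cap_nonempty n1 d0; exists z, z; split => //.
  by rewrite subrr mul0r.
have w2 : 0 < cap_width n d / 2 by lra.
have [_ [p [q [cp cq ->]]] pq] := sup_adherent w2 (has_sup_width n1 d0).
by exists p, q; split => //; move: pq; rewrite -/(cap_width n d); lra.
Qed.

(** Each [dot z (u t)] with [z] in the square varies at most by the right-hand side, and the infimum
    inherits this bound. *)
Lemma support_dist (t t' : R) :
  `|support (u t) - support (u t')| <= M * (`|cos t - cos t'| + `|sin t - sin t'|).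
Proof.
have H (x y : R) : support (u x) - support (u y) <=
    M * (`|cos x - cos y| + `|sin x - sin y|).
  rewrite lerBlDr -lerBlDl.
  apply: lb_le_inf; first by case: (has_inf_support (unit_u y)).
  move=> _ [z Kz <-].
  have : support (u x) <= dot z (u x).
    by apply: ge_inf; [case: (has_inf_support (unit_u x))|exists z].
  have -> : dot z (u x) = dot z (u y) +
      (z.1 * (cos x - cos y) + z.2 * (sin x - sin y)) by rewrite /dot/=; ring.
  suff : z.1 * (cos x - cos y) + z.2 * (sin x - sin y) <=
      M * (`|cos x - cos y| + `|sin x - sin y|) by lra.
  have := KM Kz; rewrite /square/= !in_itv/= -!ler_norml => -[z1 z2].
  rewrite (le_trans (ler_norm _))// (le_trans (ler_normD _ _))// [leRHS]mulrDr.
  by rewrite !normrM lerD// ler_wpM2r.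
rewrite ler_norml; apply/andP; split; last exact: H.
have := H t' t; rewrite (distrC (cos t')) (distrC (sin t')); lra.
Qed.

Lemma support_continuous (z : R * R) :
  continuous (fun t => dot z (u t) - support (u t)).
Proof.
move=> t; apply: cvgB.
  rewrite /dot/=; apply: cvgD; apply: cvgM.
  - exact: cvg_cst.
  - exact: continuous_cos.
  - exact: cvg_cst.
  - exact: continuous_sin.
apply/cvgrPdist_le => e e0.
have M0 : 0 <= M.
  case: K0 => y /KM[/=]; rewrite !in_itv/= => /andP[? ?] _; lra.
have d0 : 0 < e / (2 * M + 1) by rewrite divr_gt0//; lra.
have /cvgrPdist_le/(_ _ d0) c := @continuous_cos R t.
have /cvgrPdist_le/(_ _ d0) s := @continuous_sin R t.
near=> t'; apply: (le_trans (support_dist _ _)).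
apply: (@le_trans _ _ (M * (e / (2 * M + 1) + e / (2 * M + 1)))).
  apply: ler_wpM2l => //; apply: lerD; near: t'; [exact: c|exact: s].
rewrite (_ : M * _ = e * (2 * M / (2 * M + 1))); last by field; lra.
rewrite -[leRHS]mulr1 ler_wpM2l//; first exact: ltW.
by rewrite ler_pdivrMr; lra.
Unshelve. all: by end_near.
Qed.

Variables (L : R) (G : R -> R * R).
Hypotheses (L0 : 0 < L) (GK : forall s, K (G s)).
Hypothesis Glip : forall n s t, n.1 ^+ 2 + n.2 ^+ 2 = 1 ->
  `|dot (G s) n - dot (G t) n| <= `|s - t|.

(** The set of parameters is the sublevel set at height [d] of the least depth [D s] over the angles
    of the interval. By compactness the least depth is attained, so the sublevel sets decrease
    exactly to the set at depth 0, and continuity from above of a finite measure applies. *)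
Lemma cap_params_cvg (a b e : R) : a <= b -> 0 < e ->
  exists2 d0, 0 < d0 & forall d, d <= d0 ->
    fine (mu (cap_params K L G `[a, b]%classic d)) <=
    fine (mu (cap_params K L G `[a, b]%classic 0)) + e.
Proof.
move=> ab e0; pose phi s t := dot (G s) (u t) - support (u t).
pose D s := inf [set phi s t | t in `[a, b]%classic].
have Dmin s : exists2 c, `[a, b]%classic c & D s = phi s c /\
    forall t, `[a, b]%classic t -> D s <= phi s t.
  have [|c cab cmin] := @EVT_min R (phi s) a b ab.
    by apply: continuous_subspaceT; exact: support_continuous.
  have lb : has_lbound [set phi s t | t in `[a, b]%classic].
    by exists (phi s c) => _ [t /= tab <-]; exact: cmin.
  exists c => //; split.
    apply/eqP; rewrite eq_le; apply/andP; split.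
      by apply: ge_inf => //; exists c.
    apply: lb_le_inf; first by exists (phi s c); exists c.
    by move=> _ [t tab <-]; exact: cmin.
  by move=> t tab; apply: ge_inf => //; exists t.
have cpE d : cap_params K L G `[a, b]%classic d =
    `[0, L[%classic `&` [set s | D s <= d].
  apply/seteqP; split => s.
    move=> [sL [t tab /(capP _ (unit_u t) (GK s)) ct]]; split.
      by rewrite /= in_itv.
    rewrite /=.
    have [c cab [_ /(_ _ tab)]] := Dmin s; rewrite /phi; lra.
  move=> [/=]; rewrite in_itv/= => sL Dsd; split => //.
  have [c cab [Dc _]] := Dmin s; exists c => //.
  by apply/(capP _ (unit_u c) (GK s)); rewrite -/(phi s c) -Dc.
(* A minimum of 1-Lipschitz functions of [s] is 1-Lipschitz; this gives the measurability of the
   sublevel sets. *)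
have Dlip s s' : D s - D s' <= `|s - s'|.
  have [c cab [-> _]] := Dmin s'; have [_ _ [_ /(_ _ cab)]] := Dmin s.
  rewrite /phi; have := Glip s s' (unit_u c); rewrite ler_norml => /andP[_ ?]; lra.
have mD : measurable_fun setT D.
  apply: continuous_measurable_fun => s; apply/cvgrPdist_lt => r r0.
  apply/nbhs_ballP; exists r => //= s' ss'.
  apply: le_lt_trans ss'; rewrite ler_norml; apply/andP; split; last exact: Dlip.
  by rewrite lerNl opprB distrC; exact: Dlip.
have mS d : measurable (cap_params K L G `[a, b]%classic d).
  rewrite cpE; apply: measurableI; first exact: measurable_itv.
  rewrite (_ : [set s | D s <= d] = setT `&` D @^-1` `]-oo, d]%classic).
    by apply: mD => //; exact: measurable_itv.
  by rewrite setTI; apply/seteqP; split => s /=; rewrite in_itv.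
pose F (n : nat) := cap_params K L G `[a, b]%classic (n.+1%:R^-1).
have Fcap : \bigcap_n F n = cap_params K L G `[a, b]%classic 0.
  rewrite /F; under eq_bigcapr do rewrite cpE.
  rewrite cpE; apply/seteqP; split => s.
    move=> H; split; first by have [] := H 0%N Logic.I.
    rewrite /= leNgt; apply/negP => /natSinv_lt[n nD].
    by have [_ /=] := H n Logic.I; rewrite leNgt nD.
  by move=> [sL Ds] n _; split => //=; exact: le_trans Ds _.
have Foo d : (mu (cap_params K L G `[a, b]%classic d) < +oo)%E.
  exact: cap_params_fin.
have finE d : mu (cap_params K L G `[a, b]%classic d) =
    (fine (mu (cap_params K L G `[a, b]%classic d)))%:E.
  by rewrite fineK// ge0_fin_numE.
have := @nonincreasing_cvg_mu _ _ _ mu F (Foo _) (fun i => mS _).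
rewrite Fcap => /(_ (mS _)) H.
have {}H : (mu \o F) n @[n --> \oo] -->
    (fine (mu (cap_params K L G `[a, b]%classic 0)))%:E.
  rewrite -finE; apply: H => m n mn; apply/subsetPset; rewrite /F !cpE => s [sL Ds]; split => //=.
  by rewrite (le_trans Ds)// lef_pV2 ?posrE// ler_nat ltnS.
have /fine_cvgP[_ /cvgrPdist_lt/(_ _ e0)[n _ /(_ n (leqnn n)) /= Hn]] := H.
exists n.+1%:R^-1 => [|d dn]; first by rewrite invr_gt0.
have le1 : fine (mu (cap_params K L G `[a, b]%classic d)) <= fine (mu (F n)).
  apply: fine_le; [by rewrite finE|by rewrite /F finE|].
  apply: le_outer_measure; rewrite /F !cpE => s [sL Ds]; split => //=.
  exact: le_trans Ds dn.
move: Hn; rewrite ltr_norml => /andP[? ?]; lra.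
Qed.

End bounded.

(** * Normals as caps of depth zero *)

Section body.
Variables (C : set (R * R)) (L : R) (G : R -> R * R).
Hypotheses (bC : convex_body C) (GC : arclength_param C L G).

(** Both sides say that [G s] is lowest in direction [u t]: a lower bound over [C] passes to the
    closure, which contains [G s], so the infimum over [C] is reached there. *)
Lemma normals_cap (s t : R) :
  normals C G s t <-> cap (closure C) (u t) 0 (G s).
Proof.
have [/bounded_sub_square[M CM] _ [x /interior_subset Cx]] := bC.
have Ks : closure C (G s) by exact: (@arc_closure _ _ _ _ GC s).
have V0 : [set dot a (u t) | a in C] !=set0 by exists (dot x (u t)); exists x.
have Vl : has_lbound [set dot a (u t) | a in C].
  exists (- (2 * M)) => _ [z /CM Cz <-].
  by have := dot_square_le (unit_u t) Cz; rewrite ler_norml => /andP[].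
split => [N|[_ cs]].
  split => // z; rewrite addr0 -N; apply: (closure_dot_ge (unit_u t)) => a Ca.
  by apply: ge_inf => //; exists a.
apply/eqP; rewrite eq_le; apply/andP; split.
  apply: (closure_dot_ge (unit_u t) _ Ks) => a Ca.
  by apply: ge_inf => //; exists a.
apply: lb_le_inf => // _ [a Ca <-].
by have := cs a (subset_closure Ca); rewrite addr0.
Qed.

Lemma perimeter_portionE (I : set R) : perimeter_portion C L G I =
  fine (mu (cap_params (closure C) L G I 0)).
Proof.
rewrite /perimeter_portion; congr (fine (mu _)); apply/seteqP.
split => s [sL].
  by move=> [t [/normals_cap Nt It]]; split => //; exists t.
by move=> [t It Nt]; split => //; exists t; split => //; exact/normals_cap.
Qed.

End body.

End support.

(** * Conclusion *)

Section assembly.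
Context {R : realType}.
Local Notation mu := (@lebesgue_measure R).
Local Notation mu2 := (mu \x mu)%E.

Lemma dominated_shift (a b r B : R) (phi : R -> R) :
  dominated `[a + r, b + r]%classic phi B ->
  dominated `[a, b]%classic (fun t => phi (t + r)) B.
Proof.
move=> [F [mF F0 pF iF]]; exists (fun t => F (t + r)); split => //.
- by apply: measurableT_comp => //; exact: measurable_funD.
- move=> t /=; rewrite in_itv/= => /andP[? ?]; apply: pF => /=.
  by rewrite in_itv/=; apply/andP; split; lra.
- rewrite (@ge0_integralDr _ r (fun t => (F t)%:E))//.
  exact/measurable_EFinP.
Qed.

(** The lower integral of [phi] is at most the integral of its majorant. Finiteness is checked first
    because [fine] sends infinite values to 0. *)
Lemma dominated_Rintegral (I : set R) (phi : R -> R) (B : R) :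
  (forall t, 0 <= phi t) -> dominated I phi B -> \int[mu]_(t in I) phi t <= B.
Proof.
move=> p0 [F [mF F0 pF iF]]; rewrite /Rintegral -lee_fin.
have iB : (\int[mu]_(t in I) (phi t)%:E <= B%:E)%E.
  apply: le_trans iF; apply: ge0_le_integral_nonmeasurable => //.
rewrite fineK// fin_numElt (le_lt_trans iB) ?ltry// andbT.
by apply: (@lt_le_trans _ _ 0%E) => //; apply: integral_ge0 => t _; rewrite lee_fin.
Qed.

Section body.
Variables (C : set (R * R)) (L : R) (G : R -> R * R).
Hypotheses (bC : convex_body C) (GC : arclength_param C L G).
Let K := closure C.

(** Here [f] stands for cosine or sine. The integrand is a function of [dot x (u t)] with antiperiod
    [h = (2 * rho)^-1], so the caps have depth [2 * h = rho^-1]; the cap opposite to [u t] is the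
    one for the angle [t + pi]. *)
Lemma Rintegral_body_le (M rho t : R) (f : R -> R) : K `<=` square M -> 0 < rho ->
  measurable_fun setT f -> (forall x, `|f x| <= 1) -> (forall x, f (x - pi) = - f x) ->
  `|\int[mu2]_(x in C) f (- (2 * pi * dot x (rho *: u t)))| <=
  2 * rho^-1 * (cap_width K (u t) rho^-1 + cap_width K (u (t + pi)) rho^-1).
Proof.
move=> KM rho0 mf f1 fpi.
have [_ cC [x0 Ix0]] := bC.
have Cx0 : C x0 by exact: interior_subset.
have K0 : K !=set0 by exists x0; exact: subset_closure.
have d0 : 0 < rho^-1 by rewrite invr_gt0.
have uN : u (t + pi) = - u t.
  by rewrite /u cosDpi sinDpi.
pose g s := f (- (2 * pi * rho * s)).
have mg : measurable_fun setT g.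
  apply: (measurableT_comp mf).
  by apply: measurable_funN; apply: measurable_funM.
have mK : measurable K by apply: closed_measurable_plane; exact: closed_closure.
have -> : \int[mu2]_(x in C) f (- (2 * pi * dot x (rho *: u t))) =
    \int[mu2]_(x in K) g (dot x (u t)).
  (* The body is replaced by its closure, which is measurable; the two differ inside the null
     boundary. *)
  transitivity (\int[mu2]_(x in C) g (dot x (u t))).
    apply: eq_Rintegral => x _; rewrite /g; congr (f (- _)).
    by rewrite /dot/= /GRing.scale/=; ring.
  apply: (@Rintegral_null_sandwich R _ _ mu2 (C°) K C (fun x => g (dot x (u t)))) => //.
  - by apply: open_measurable_plane; exact: open_interior.
  - exact: interior_subset.
  - exact: subset_closure.
  - exact: (boundary_null GC).
  - apply: (measurableT_comp mg).
    exact: (measurable_funD (measurable_funM measurable_fst (measurable_cst _))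
      (measurable_funM measurable_snd (measurable_cst _))).
pose W := cap_width K (u t) rho^-1 + cap_width K (u (t + pi)) rho^-1.
have W1 : 0 <= cap_width K (u t) rho^-1 by apply: (cap_width_ge0 KM K0 (unit_u t)).
have W2 : 0 <= cap_width K (u (t + pi)) rho^-1.
  by apply: (cap_width_ge0 KM K0 (unit_u (t + pi))).
have -> : 2 * rho^-1 = 4 * (2 * rho)^-1.
  by field; rewrite gt_eqF.
have hE : 2 * (2 * rho)^-1 = rho^-1 by field; rewrite gt_eqF.
apply: (normr_Rintegral_cap mK KM _ K0 (unit_u t)) => //.
- by apply: plane_convex_closure; exact: plane_convex_of_convex_set.
- by rewrite invr_gt0; lra.
- by rewrite addr_ge0.
- by move=> s; rewrite /g.
- move=> s; rewrite /g -fpi; congr f.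
  by field; rewrite gt_eqF.
- rewrite hE => p q cp cq.
  have := cap_width_leP KM K0 (unit_u t) d0 cp cq; lra.
- rewrite hE -uN => p q cp cq.
  have := cap_width_leP KM K0 (unit_u (t + pi)) d0 cp cq; lra.
Qed.

(** The squares of the real and imaginary parts add up to at most [8 * rho ^- 2 * (W1 + W2) ^+ 2],
    with [W1], [W2] the two cap widths. The widths appear halved because half a width is what a pair
    of points of the cap is sure to realize. *)
Lemma normc_indic_hat_le (M rho t : R) : K `<=` square M -> 0 < rho ->
  Normc.normc (indic_hat C (rho *: u t)) ^+ 2 <=
  64 * rho ^- 2 * ((cap_width K (u t) rho^-1 / 2) ^+ 2 +
                   (cap_width K (u (t + pi)) rho^-1 / 2) ^+ 2).
Proof.
move=> KM rho0; have r0 : 0 < rho^-1 by rewrite invr_gt0.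
have [_ _ [x0 /interior_subset Cx0]] := bC.
have K0 : K !=set0 by exists x0; exact: subset_closure.
have cos1 (x : R) : `|cos x| <= 1 by rewrite ler_norml cos_le1 cos_geN1.
have sin1 (x : R) : `|sin x| <= 1 by rewrite ler_norml sin_le1 sin_geN1.
have cospi (x : R) : cos (x - pi) = - cos x by rewrite -[x in RHS](subrK pi) cosDpi opprK.
have sinpi (x : R) : sin (x - pi) = - sin x by rewrite -[x in RHS](subrK pi) sinDpi opprK.
have := Rintegral_body_le t KM rho0
  (continuous_measurable_fun (@continuous_cos R)) cos1 cospi.
have := Rintegral_body_le t KM rho0
  (continuous_measurable_fun (@continuous_sin R)) sin1 sinpi.
rewrite /indic_hat /cintegral /expi /=.
set W1 := cap_width _ _ _; set W2 := cap_width _ _ _.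
have W10 : 0 <= W1 by apply: (cap_width_ge0 KM K0 (unit_u t)).
have W20 : 0 <= W2 by apply: (cap_width_ge0 KM K0 (unit_u (t + pi))).
set x := (X in `|X| <= _ -> _); set y := (X in _ -> `|X| <= _ -> _) => xW yW.
rewrite sqr_sqrtr; last by rewrite addr_ge0// sqr_ge0.
have sq (z : R) : `|z| <= 2 * rho^-1 * (W1 + W2) ->
    z ^+ 2 <= (2 * rho^-1 * (W1 + W2)) ^+ 2.
  by move=> zW; rewrite -real_normK ?num_real// ler_sqr ?nnegrE// (le_trans _ zW).
rewrite (le_trans (lerD (sq _ yW) (sq _ xW)))//.
rewrite -subr_ge0 -exprVn.
(* The gap in the inequality between (W1+W2)^2 and 2(W1^2+W2^2) is (W1-W2)^2. *)
rewrite [X in 0 <= X](_ : _ = 8 * rho^-1 ^+ 2 * (W1 - W2) ^+ 2); last first.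
  by move: (rho^-1) => r; field.
by rewrite mulr_ge0 ?sqr_ge0// mulr_ge0// sqr_ge0.
Qed.

Lemma Rintegral_indic_hat_le (M a b rho : R) (m : nat) : K `<=` square M ->
  a < b -> b - a <= m.+1%:R -> 0 < rho ->
  \int[mu]_(t in `[a, b]%classic) (Normc.normc (indic_hat C (rho *: u t))) ^+ 2 <=
  64 * 768 * m.+1%:R * rho ^- 3 *
    (fine (mu (cap_params K L G `[a, b]%classic (3 * rho^-1))) +
     fine (mu (cap_params K L G `[a + pi, b + pi]%classic (3 * rho^-1)))).
Proof.
move=> KM ab abm rho0; have r0 : 0 < rho^-1 by rewrite invr_gt0.
have [_ cC [x0 /interior_subset Cx0]] := bC.
have K0 : K !=set0 by exists x0; exact: subset_closure.
have [L0 _ _ _ _] := GC.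
have cK : closed K by exact: closed_closure.
have convK : plane_convex K.
  by apply: plane_convex_closure; exact: plane_convex_of_convex_set.
have GK s : K (G s) by exact: (@arc_closure _ _ _ _ GC s).
pose l s := cap_width K (u s) rho^-1 / 2.
have lD s : 0 <= l s <= 4 * M.
  have := cap_width_ge0 KM K0 (unit_u s) r0.
  have := cap_width_le4 KM K0 (unit_u s) r0.
  by rewrite /l => ? ?; apply/andP; split; lra.
have lcap s : exists p q, [/\ cap K (u s) rho^-1 p, cap K (u s) rho^-1 q &
    l s <= dot q (perp (u s)) - dot p (perp (u s))].
  exact: (cap_width_attained KM K0 (unit_u s) r0).
have dom a' b' e : a' < b' -> b' - a' <= m.+1%:R -> 0 < e ->
    dominated `[a', b']%classic (fun s => l s ^+ 2)
    (m.+1%:R * (768 * rho^-1 *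
      fine (mu (cap_params K L G `[a', b']%classic (3 * rho^-1)))) + e).
  move=> ab' abm' e0.
  apply: (cap_width_dominated cK KM convK L0 GK (arclength_lip GC)
    (closure_boundary GC) ab' abm' r0 e0) => s _; [exact: lD|exact: lcap].
apply/ler_addgt0Pr => e e0.
(* Two errors [e'], one for each of the opposite caps, multiplied by [64 * rho ^- 2] add up to
   [e]. *)
pose e' := e / (128 * rho ^- 2).
have q0 : 0 < rho ^- 2 by rewrite -exprVn exprn_gt0.
have e'0 : 0 < e' by rewrite divr_gt0// mulr_gt0.
have D1 := dom _ _ _ ab abm e'0.
have D2 : dominated `[a, b]%classic (fun s => l (s + pi) ^+ 2)
    (m.+1%:R * (768 * rho^-1 *
      fine (mu (cap_params K L G `[a + pi, b + pi]%classic (3 * rho^-1)))) + e').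
  apply: (@dominated_shift _ _ _ _ (fun s => l s ^+ 2)); apply: dom => //.
    by rewrite ltrD2r.
  by rewrite (_ : _ - _ = b - a)//; ring.
have c0 : 0 <= 64 * rho ^- 2 by rewrite mulr_ge0// ltW.
apply: dominated_Rintegral => [s|]; first exact: sqr_ge0.
apply: (dominated_le (dominatedZ c0 (dominatedD D1 D2))) => [s _|].
  exact: (@normc_indic_hat_le M).
rewrite le_eqVlt; apply/orP; left; apply/eqP.
rewrite /e'; set S1 := fine _; set S2 := fine _.
by field; rewrite gt_eqF.
Qed.

End body.
End assembly.

Theorem lemma3p9 (R : realType) :
  exists2 c : R, 0 < c &
  forall (C : set (R * R)) (L : R) (G : R -> R * R) (a b : R),
    convex_body C -> arclength_param C L G ->
    a < b -> b <= a + 2 * pi ->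
    let I : set R := [set` `[a, b]] in
    let P : R := perimeter_portion C L G I +
                 perimeter_portion C L G [set t + pi | t in I] in
    let J : R -> R := fun rho =>
      \int[lebesgue_measure]_(t in I) (Normc.normc (indic_hat C (rho *: u t))) ^+ 2 in
    (P != 0 -> preceq_with c J (fun rho => rho ^- 3 * P)) /\
    (P = 0 -> rho ^+ 3 * J rho @[rho --> +oo] --> (0 : R)).
Proof.
have pi20 : 0 <= 2 * pi :> R by rewrite mulr_ge0// pi_ge0.
have /andP[_ mpi] := truncn_itv pi20.
(* The full circle is shorter than [m.+1], so this number of pieces serves every interval and the
   constant is independent of [C] and [I]. *)
set m := Num.truncn _ in mpi.
pose c0 : R := 64 * 768 * m.+1%:R.
have c00 : 0 < c0 by apply: mulr_gt0; [lra|exact: ltr0Sn].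
exists (2 * c0); first by rewrite mulr_gt0.
move=> C L G a b bC GC ab bpi I P J.
have [/bounded_sub_square[M CM] cC [x0 /interior_subset Cx0]] := bC.
have KM := closure_sub_square CM.
have K0 : closure C !=set0 by exists x0; exact: subset_closure.
have [L0 _ _ _ _] := GC.
have GK s : closure C (G s) by exact: (@arc_closure _ _ _ _ GC s).
have Ipi : [set t + pi | t in I] = `[a + pi, b + pi]%classic.
  apply/seteqP; split => [_ [t It <-]|t It].
    have : t \in `[a, b] by [].
    rewrite in_itv/= => /andP[t1 t2].
    by rewrite /mkset in_itv/=; apply/andP; split; lra.
  have : t \in `[a + pi, b + pi] by [].
  rewrite in_itv/= => /andP[t1 t2]; exists (t - pi); last by rewrite subrK.
  by rewrite /I /mkset in_itv/=; apply/andP; split; lra.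
have PE : P = fine (lebesgue_measure (cap_params (closure C) L G `[a, b]%classic 0)) +
    fine (lebesgue_measure (cap_params (closure C) L G `[a + pi, b + pi]%classic 0)).
  by rewrite /P Ipi !(perimeter_portionE bC GC).
have P0 : 0 <= P by rewrite PE addr_ge0// fine_ge0.
have J0 rho : 0 <= J rho by apply: Rintegral_ge0 => t _; exact: sqr_ge0.
(* The estimate common to both cases: the constant [c0] is universal, and only the threshold depends
   on the body, the interval and [e]. *)
have J_near e : 0 < e -> exists2 r : R, 0 < r &
    forall rho, r < rho -> rho ^+ 3 * J rho <= c0 * (P + e).
  move=> e0; have e2 : 0 < e / 2 by lra.
  have abpi : a + pi <= b + pi by rewrite lerD2r ltW.
  have [d1 d10 H1] := cap_params_cvg KM K0 L0 GK (arclength_lip GC) (ltW ab) e2.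
  have [d2 d20 H2] := cap_params_cvg KM K0 L0 GK (arclength_lip GC) abpi e2.
  pose d := Num.min d1 d2.
  have d0 : 0 < d by rewrite lt_min d10.
  (* Beyond this threshold the depth [3 * rho^-1] of the boundary parameters is at most [d]. *)
  exists (3 / d) => [|rho rhod]; first by rewrite divr_gt0.
  have rho0 : 0 < rho by apply: lt_trans rhod; rewrite divr_gt0.
  have : 3 * rho^-1 <= d.
    by rewrite ler_pdivrMr// mulrC -ler_pdivrMr// ltW.
  rewrite le_min => /andP[/H1 S1 /H2 S2].
  have bam : b - a <= m.+1%:R by move: mpi; lra.
  have := Rintegral_indic_hat_le bC GC KM ab bam rho0.
  rewrite -/(J rho) -/c0 => HJ.
  have rho3 : 0 < rho ^+ 3 by rewrite exprn_gt0.
  rewrite mulrC -ler_pdivlMr// (le_trans HJ)// mulrAC.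
  apply: ler_wpM2r; first by rewrite invr_ge0 ltW.
  by rewrite ler_pM2l// PE; lra.
split=> [Pn0|Pe0].
  have {P0 Pn0}P0 : 0 < P by rewrite lt_neqAle eq_sym Pn0.
  (* Taking the error equal to [P] itself costs the factor 2 in the constant [2 * c0]. *)
  have [r r0 Hr] := J_near P P0.
  (* The upper limit is at most the supremum over the neighbourhood of points beyond [r]. *)
  apply: (@le_trans _ _ (ereal_sup [set (J x / (x ^- 3 * P))%:E | x in [set x | r < x]])).
    apply: ereal_inf_lbound; exists [set x | r < x] => //.
    by exists r; split => //; exact: num_real.
  apply: ge_ereal_sup => _ [x /= rx <-]; rewrite lee_fin.
  have x0' : 0 < x by exact: lt_trans rx.
  have x3 : 0 < x ^+ 3 by rewrite exprn_gt0.
  rewrite ler_pdivrMr; last by rewrite mulr_gt0// invr_gt0.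
  have := Hr _ rx; rewrite mulrC -ler_pdivlMr// => /le_trans; apply.
  by rewrite le_eqVlt; apply/orP; left; apply/eqP; ring.
apply/cvgrPdist_le => e e0.
have [r r0 Hr] := J_near (e / c0) (divr_gt0 e0 c00).
exists r; split; first exact: num_real.
move=> x rx; have x0' : 0 < x by exact: lt_trans rx.
have := Hr _ rx; rewrite Pe0 add0r mulrCA mulfV ?gt_eqF// mulr1.
by rewrite sub0r normrN ger0_norm// mulr_ge0// exprn_ge0// ltW.
Qed.
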